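(* Let $T$ be a complete theory. The following are equivalent: (1) $T$ is unimodular. (2) $T$ is correspondence unimodular for complete types. (3) $T$ is functionally unimodular for complete types.
   Context: We work in a sufficiently saturated and ultrahomogeneous monster model of $T$, and in $T^{eq}$ (tuples are finite and may consist of imaginary elements; parameter sets are small). If $a$ is algebraic over $B$, $m(a/B)$ denotes the (finite) number of realizations of $\mathrm{tp}(a/B)$. Write $a\equiv_A b$ for $\mathrm{tp}(a/A)=\mathrm{tp}(b/A)$. Two tuples $a,b$ are interalgebraic over $A$ if $a\in\mathrm{acl}(Ab)$ and $b\in\mathrm{acl}(Aa)$. $T$ is unimodular if for any tuples $a,b$ and parameter set $A$ in the monster model, if $a\equiv_A b$ and $a,b$ are interalgebraic over $A$, then $m(a/Ab)=m(b/Aa)$. A correspondence between type-definable sets $\pi,\pi'$ is a non-empty type-definable set $C(x,y)\vdash\pi(x)\times\pi'(y)$ such that all fibres $C_x=\{y\models\pi': C(x,y)\}$ ($x\models\pi$) and $C^y=\{x\models\pi: C(x,y)\}$ ($y\models\pi'$) are finite. It is over $A$ if $\pi,\pi',C$ are all type-definable over $A$. It is uniform if $k_C=|C_x|$ and $\ell_C=|C^y|$ are constant, independent of $x\models\pi$ and $y\models\pi'$; its ratio is then $m_C=k_C/\ell_C$. $T$ is correspondence unimodular for complete types if for any parameter set $A$, any two complete types $p,q$ over $A$ and any two uniform correspondences $C_1,C_2$ over $A$ between $p$ and $q$, one has $m_{C_1}=m_{C_2}$. $T$ is functionally unimodular for complete types if for any parameter set $A$ and any two complete types $X,Y$ over $A$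 (identified with their sets of realizations): whenever two relatively $A$-definable functions $f,g:X\to Y$ have constant finite fibre sizes $k$ and $\ell$ respectively, then $k=\ell$. *)

(* Defs.v *)
From mathcomp Require Import all_boot all_order all_algebra.
From mathcomp Require Import all_classical.

Set Implicit Arguments.
Unset Strict Implicit.
Unset Printing Implicit Defensive.

Import GRing.Theory.
Local Open Scope classical_set_scope.
Local Open Scope card_scope.

(** * Many-sorted first-order logic *)

(* One-sorted languages are the case [lsort := unit]; several sorts are needed
   for T^eq anyway.  A context is a list of sorts, its entries being the sorts
   of the free variables (de Bruijn indices). *)
Record language := Language {
  lsort : Type;
  lfn : Type;
  fdom : lfn -> seq lsort;
  fcod : lfn -> lsort;
  lrel : Type;
  rdom : lrel -> seq lsort }.

Inductive var (S : Type) : seq S -> S -> Type :=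
| Vz (s : S) (G : seq S) : var (s :: G) s
| Vs (s t : S) (G : seq S) : var G s -> var (t :: G) s.

Inductive term (L : language) (G : seq (lsort L)) : lsort L -> Type :=
| Tvar s : var G s -> term G s
| Tapp (f : lfn L) : terms G (fdom f) -> term G (fcod f)
with terms (L : language) (G : seq (lsort L)) : seq (lsort L) -> Type :=
| Tnil : terms G [::]
| Tcons s D : term G s -> terms G D -> terms G (s :: D).

Inductive formula (L : language) : seq (lsort L) -> Type :=
| Feq G (s : lsort L) : term G s -> term G s -> formula G
| Frel G (r : lrel L) : terms G (rdom r) -> formula G
| Fbot G : formula G
| Fimp G : formula G -> formula G -> formula G
| Fall G (s : lsort L) : formula (s :: G) -> formula G.

Definition Fneg (L : language) (G : seq (lsort L)) (phi : formula G) :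
  formula G := Fimp phi (Fbot G).

(* Finite tuples of the sorts listed in [G]. *)
Fixpoint env (S : Type) (C : S -> Type) (G : seq S) : Type :=
  if G is s :: G' then (C s * env C G')%type else unit.

Fixpoint ecat (S : Type) (C : S -> Type) (G D : seq S) :
    env C G -> env C D -> env C (G ++ D) :=
  match G with
  | [::] => fun _ d => d
  | s :: G' => fun g d => (g.1, ecat g.2 d)
  end.

Fixpoint emap (S : Type) (C : S -> Type) (f : forall s, C s -> C s)
    (G : seq S) : env C G -> env C G :=
  match G with
  | [::] => fun e => e
  | s :: G' => fun e => (f s e.1, emap f e.2)
  end.

Fixpoint elems (S : Type) (C : S -> Type) (G : seq S) :
    env C G -> set {s : S & C s} :=
  match G with
  | [::] => fun _ => set0
  | s :: G' => fun e => [set existT C s e.1] `|` elems e.2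
  end.

Fixpoint elookup (S : Type) (C : S -> Type) (G : seq S) (s : S)
    (x : var G s) : env C G -> C s :=
  match x in var G s return env C G -> C s with
  | Vz s G => fun e => e.1
  | Vs s t G y => fun e => elookup y e.2
  end.

Record structure (L : language) := Structure {
  carrier :> lsort L -> Type;
  finterp : forall f : lfn L, env carrier (fdom f) -> carrier (fcod f);
  rinterp : forall r : lrel L, env carrier (rdom r) -> Prop;
  carrier_inhabited : forall s, inhabited (carrier s) }.

Fixpoint teval (L : language) (M : structure L) (G : seq (lsort L))
    (e : env M G) (s : lsort L) (t : term G s) : M s :=
  match t with
  | Tvar s x => elookup x e
  | Tapp f ts => finterp (tseval e ts)
  end
with tseval (L : language) (M : structure L) (G : seq (lsort L))
    (e : env M G) (D : seq (lsort L)) (ts : terms G D) : env M D :=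
  match ts in terms _ D return env M D with
  | Tnil => tt
  | Tcons s D t ts => (teval e t, tseval e ts)
  end.

Fixpoint sat (L : language) (M : structure L) (G : seq (lsort L))
    (phi : formula G) : env M G -> Prop :=
  match phi in formula G return env M G -> Prop with
  | Feq G s t u => fun e => teval e t = teval e u
  | Frel G r ts => fun e => rinterp (tseval e ts)
  | Fbot G => fun _ => False
  | Fimp G phi psi => fun e => sat phi e -> sat psi e
  | Fall G s phi => fun e => forall x : M s, @sat L M (s :: G) phi (x, e)
  end.

Definition theory (L : language) := set (@formula L [::]).

Definition is_model (L : language) (T : theory L) (M : structure L) :=
  forall phi, T phi -> @sat L M [::] phi tt.

Definition entails (L : language) (T : theory L) (phi : @formula L [::]) :=
  forall M : structure L, is_model T M -> @sat L M [::] phi tt.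

Definition complete_theory (L : language) (T : theory L) :=
  (exists M : structure L, is_model T M) /\
  forall phi, entails T phi \/ entails T (Fneg phi).

(** * Parameters, types, definable sets *)

(* Formulas in the variables [G] with parameters from [M]. *)
Record pformula (L : language) (M : structure L) (G : seq (lsort L)) :=
  PFormula {
    pctx : seq (lsort L);
    pfml : formula (G ++ pctx);
    ppar : env M pctx }.

Definition psat (L : language) (M : structure L) (G : seq (lsort L))
  (phi : pformula M G) (a : env M G) := sat (pfml phi) (ecat a (ppar phi)).

Definition pneg (L : language) (M : structure L) (G : seq (lsort L))
  (phi : pformula M G) : pformula M G := PFormula (Fneg (pfml phi)) (ppar phi).

Section Types.
Variables (L : language) (M : structure L).
Implicit Types (A : set {s : lsort L & M s}) (G D : seq (lsort L)).

Definition params_in A G (phi : pformula M G) := elems (ppar phi) `<=` A.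

Definition definable A G (X : set (env M G)) :=
  exists2 phi, params_in A phi & X = psat phi.

Definition realizations G (p : set (pformula M G)) : set (env M G) :=
  [set a | forall phi, p phi -> psat phi a].

Definition type_definable A G (X : set (env M G)) :=
  exists2 p : set (pformula M G),
    p `<=` [set phi | params_in A phi] & X = realizations p.

Definition finitely_satisfiable G (p : set (pformula M G)) :=
  forall q, q `<=` p -> finite_set q -> realizations q !=set0.

Definition complete_type A G (p : set (pformula M G)) :=
  [/\ p `<=` [set phi | params_in A phi], finitely_satisfiable p &
      forall phi, params_in A phi -> p phi \/ p (pneg phi)].

Definition tp G (a : env M G) A : set (pformula M G) :=
  [set phi | params_in A phi /\ psat phi a].

Definition acl A G : set (env M G) :=
  [set a | exists X, [/\ definable A X, finite_set X & X a]].

(* The parameter set written Ab in model theory. *)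
Definition adjoin A G (b : env M G) := A `|` elems b.

Definition interalgebraic A G D (a : env M G) (b : env M D) :=
  acl (adjoin A b) a /\ acl (adjoin A a) b.

(* The number of elements of a finite set; junk value 0 on infinite sets. *)
Definition ncard (U : Type) (X : set U) : nat :=
  xget 0%N [set n : nat | X #= `I_n].

Definition mult G (a : env M G) A : nat := ncard (realizations (tp a A)).

(** * Saturation and homogeneity *)

(* [K] is a type of cardinality kappa; small means of size < kappa. *)
Definition small (K : Type) A := ~~ ([set: K] #<= A).

Definition saturated (K : Type) :=
  forall A, small K A -> forall G (p : set (pformula M G)),
    complete_type A p -> realizations p !=set0.

Definition partial_elementary A (f : forall s, M s -> M s) :=
  forall G (phi : formula G) (c : env M G), elems c `<=` A ->
    (sat phi c <-> sat phi (emap f c)).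

Definition automorphism (g : forall s, M s -> M s) :=
  [/\ forall s, bijective (g s),
      forall (f : lfn L) (x : env M (fdom f)),
        g _ (finterp x) = finterp (emap g x) &
      forall (r : lrel L) (x : env M (rdom r)),
        rinterp x <-> rinterp (emap g x)].

(* Values of [f] outside [A] are irrelevant. *)
Definition strongly_homogeneous (K : Type) :=
  forall A (f : forall s, M s -> M s), small K A -> partial_elementary A f ->
    exists2 g, automorphism g &
      forall (s : lsort L) (x : M s), A (existT _ s x) -> g s x = f s x.

End Types.

(* kappa > |T|, where |T| is the number of L-formulas. *)
Definition monster_model (L : language) (T : theory L) (K : Type)
    (M : structure L) :=
  [/\ is_model T M,
      ~~ ([set: K] #<= [set: {G : seq (lsort L) & formula G}]),
      saturated M K & strongly_homogeneous M K].

(** * Imaginaries *)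

Section Eq.
Variables (L : language) (M : structure L).

(* For M a model of a complete theory T, the formulas defining an equivalence
   relation in M are those which do so modulo T. *)
Record defeq := DefEq {
  ectx : seq (lsort L);
  efml : formula (ectx ++ ectx);
  eequiv : RelationClasses.Equivalence
    (fun x y : env M ectx => sat efml (ecat x y)) }.

Inductive eqsort := Home of lsort L | Imag of defeq.

Definition eclass (E : defeq) (x : env M (ectx E)) : set (env M (ectx E)) :=
  [set y | sat (efml E) (ecat x y)].

Definition eqcarrier (s : eqsort) : Type :=
  match s with
  | Home s => M s
  | Imag E => {X : set (env M (ectx E)) | exists x, X = eclass x}
  end.

Inductive eqfn := Lfn of lfn L | Proj of defeq.

Definition eqlang : language := {|
  lsort := eqsort;
  lfn := eqfn;
  fdom f := match f with
            | Lfn f => map Home (fdom f)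
            | Proj E => map Home (ectx E)
            end;
  fcod f := match f with Lfn f => Home (fcod f) | Proj E => Imag E end;
  lrel := lrel L;
  rdom r := map Home (rdom r) |}.

Fixpoint unhome (G : seq (lsort L)) : env eqcarrier (map Home G) -> env M G :=
  match G with
  | [::] => fun e => e
  | s :: G' => fun e => (e.1, unhome e.2)
  end.

Definition eqproj (E : defeq) (x : env M (ectx E)) : eqcarrier (Imag E) :=
  exist _ (eclass x) (ex_intro _ x erefl).

Definition eqfinterp (f : eqfn) :
    env eqcarrier (@fdom eqlang f) -> eqcarrier (@fcod eqlang f) :=
  match f with
  | Lfn f => fun e => finterp (unhome e)
  | Proj E => fun e => eqproj (unhome e)
  end.

Lemma env_inhabited (G : seq (lsort L)) : inhabited (env M G).
Proof.
elim: G => [|s G [e]] /=; first exact: (inhabits tt).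
by have [x] := carrier_inhabited M s; exact: (inhabits (x, e)).
Qed.

Lemma eqcarrier_inhabited (s : eqsort) : inhabited (eqcarrier s).
Proof.
case: s => [s|E]; first exact: carrier_inhabited.
by have [e] := env_inhabited (ectx E); exact: (inhabits (eqproj e)).
Qed.

(* M^eq *)
Definition Meq : structure eqlang :=
  @Structure eqlang eqcarrier eqfinterp
    (fun (r : lrel L) (e : env eqcarrier (map Home (rdom r))) =>
       rinterp (unhome e))
    eqcarrier_inhabited.

End Eq.

(** * Unimodularity *)

(* These are stated for an arbitrary many-sorted structure [N]; unimodularity
   of T is obtained with [N := Meq M] for a monster model [M] of T. *)
Section Unimodularity.
Variables (L : language) (N : structure L) (K : Type).
Implicit Types (A : set {s : lsort L & N s}) (G D : seq (lsort L)).

Definition unimodular :=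
  forall A G (a b : env N G), small K A ->
    tp a A = tp b A -> interalgebraic A a b ->
    mult a (adjoin A b) = mult b (adjoin A a).

Definition fibre_l G D (Y : set (env N D)) (C : set (env N (G ++ D)))
  (x : env N G) : set (env N D) := [set y | Y y /\ C (ecat x y)].

Definition fibre_r G D (X : set (env N G)) (C : set (env N (G ++ D)))
  (y : env N D) : set (env N G) := [set x | X x /\ C (ecat x y)].

Record correspondence A G D (X : set (env N G)) (Y : set (env N D))
    (C : set (env N (G ++ D))) : Prop := {
  corr_tdef_l : type_definable A X;
  corr_tdef_r : type_definable A Y;
  corr_tdef : type_definable A C;
  corr_nonempty : C !=set0;
  corr_sub : forall x y, C (ecat x y) -> X x /\ Y y;
  corr_fin_l : forall x, X x -> finite_set (fibre_l Y C x);
  corr_fin_r : forall y, Y y -> finite_set (fibre_r X C y) }.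

(* [k] and [l] are the constants k_C and l_C. *)
Definition uniform G D (X : set (env N G)) (Y : set (env N D))
    (C : set (env N (G ++ D))) (k l : nat) :=
  (forall x, X x -> fibre_l Y C x #= `I_k) /\
  (forall y, Y y -> fibre_r X C y #= `I_l).

Definition ratio (k l : nat) : rat := (k%:R / l%:R)%R.

Definition correspondence_unimodular :=
  forall A G D (p : set (pformula N G)) (q : set (pformula N D))
    (C1 C2 : set (env N (G ++ D))) (k1 l1 k2 l2 : nat),
    let X := realizations p in let Y := realizations q in
    small K A -> complete_type A p -> complete_type A q ->
    correspondence A X Y C1 -> uniform X Y C1 k1 l1 ->
    correspondence A X Y C2 -> uniform X Y C2 k2 l2 ->
    ratio k1 l1 = ratio k2 l2.

(* A function X -> Y is the restriction to [X] of a total [f]; its graph is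
   required to be the trace on X * Y of an [A]-definable set. *)
Definition rel_definable_fun A G D (X : set (env N G)) (Y : set (env N D))
    (f : env N G -> env N D) :=
  set_fun X Y f /\
  exists2 Z : set (env N (G ++ D)), definable A Z &
    forall x y, X x -> Y y -> (Z (ecat x y) <-> y = f x).

Definition fibres_of_size G D (X : set (env N G)) (Y : set (env N D))
    (f : env N G -> env N D) (k : nat) :=
  forall y, Y y -> (X `&` f @^-1` [set y]) #= `I_k.

Definition functionally_unimodular :=
  forall A G D (p : set (pformula N G)) (q : set (pformula N D))
    (f g : env N G -> env N D) (k l : nat),
    let X := realizations p in let Y := realizations q in
    small K A -> complete_type A p -> complete_type A q ->
    rel_definable_fun A X Y f -> fibres_of_size X Y f k ->
    rel_definable_fun A X Y g -> fibres_of_size X Y g l ->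
    k = l.

End Unimodularity.

(* Main.v *)
Require Import Defs.
From mathcomp Require Import all_boot all_classical.
From mathcomp Require Import finmap ssralg ssrnum rat.

Set Implicit Arguments.
Unset Strict Implicit.
Unset Printing Implicit Defensive.

Local Open Scope classical_set_scope.
Local Open Scope card_scope.

(* Everything takes place in N = M^eq.  Translating formulas of M^eq about
   classes into formulas of M about representatives shows that N is compact for
   types over small sets; back-and-forth with lists of realizations then shows
   that the cardinality of a fibre over [a] of an A-invariant relation depends
   only on tp(a/A), and no automorphism is needed.

   (3) => (1): the two projections of tp(ab/A) to tp(a/A) = tp(b/A) have fibres
   of sizes m(b/Aa) and m(a/Ab).
   (2) => (3): a function with fibres of size k has a graph of ratio 1/k.
   (1) => (2): given C1, C2 from p to q, fix a |= p and weight a pair (x, z) of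
   realizations of p by the number of y with C1(x, y) and C2(z, y).  The pairs
   (a, z) have total weight k1 l2, the pairs (x, a) total weight k2 l1, and by
   unimodularity each type of pairs is realized equally often on both sides. *)

(** * Tuples and term maps *)

Section Env.
Variables (S : Type) (C : S -> Type).
Implicit Types G D : seq S.

Fixpoint etake G D : env C (G ++ D) -> env C G :=
  match G with
  | [::] => fun _ => tt
  | s :: G' => fun e => (e.1, etake e.2)
  end.

Fixpoint edrop G D : env C (G ++ D) -> env C D :=
  match G with
  | [::] => fun e => e
  | s :: G' => fun e => edrop e.2
  end.

Lemma etakeK G D (a : env C G) (b : env C D) : etake (ecat a b) = a.
Proof. by elim: G a => [|s G IH] /= []// x a; rewrite IH. Qed.

Lemma edropK G D (a : env C G) (b : env C D) : edrop (ecat a b) = b.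
Proof. by elim: G a => [|s G IH] /= []// x a; rewrite IH. Qed.

Lemma ecat_take_drop G D (e : env C (G ++ D)) : ecat (etake e) (edrop e) = e.
Proof. by elim: G e => [|s G IH] //= [x e] /=; rewrite IH. Qed.

Lemma ecat_inj G D (a a' : env C G) (b b' : env C D) :
  ecat a b = ecat a' b' -> a = a' /\ b = b'.
Proof.
move=> e; split; first by rewrite -(etakeK a b) e etakeK.
by rewrite -(edropK a b) e edropK.
Qed.

Lemma elems_ecat G D (a : env C G) (b : env C D) :
  elems (ecat a b) = elems a `|` elems b.
Proof.
by elim: G a => [|s G IH] /= a; rewrite ?set0U// IH setUA.
Qed.

Lemma finite_elems G (a : env C G) : finite_set (elems a).
Proof.
elim: G a => [|s G IH] /= a; first exact: finite_set0.
by rewrite finite_setU; split; [exact: finite_set1 | exact: IH].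
Qed.

End Env.

Scheme term_terms_ind := Induction for term Sort Prop
  with terms_term_ind := Induction for terms Sort Prop.
Combined Scheme term_mutind from term_terms_ind, terms_term_ind.

Section TermMaps.
Variables (L : language) (M : structure L).
Implicit Types G D P : seq (lsort L).

(** A semantic form of substitution: only the existence of terms for the coordinates is recorded.
    Weakening, permutation and projection of variables thus become one notion, with no syntactic
    renaming of de Bruijn indices. *)
Fixpoint tmap G D : (env M G -> env M D) -> Prop :=
  match D with
  | [::] => fun _ => True
  | s :: D' => fun h => (exists t : term G s, forall e, teval e t = (h e).1) /\
                        @tmap G D' (fun e => (h e).2)
  end.

Lemma tmap_of_var G D (h : env M G -> env M D) :
  (forall s (x : var D s), exists t : term G s,
     forall e, teval e t = elookup x (h e)) -> tmap h.
Proof.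
elim: D h => [|s D IH] //= h H; split; first exact: (H _ (Vz s D)).
by apply: IH => t x; exact: (H _ (Vs s x)).
Qed.

Lemma tmap_lookup G D (h : env M G -> env M D) : tmap h ->
  forall s (x : var D s), exists t : term G s,
    forall e, teval e t = elookup x (h e).
Proof.
move=> Hh s x; elim: x h Hh => [{}s {}D|{}s t {}D x IH] h /= [H1 H2] //.
exact: IH H2.
Qed.

Lemma tmap_id G : tmap (fun e : env M G => e).
Proof. by apply: tmap_of_var => s x; exists (Tvar x). Qed.

Lemma tmap_tail s G : tmap (fun e : env M (s :: G) => e.2).
Proof. by apply: tmap_of_var => t x; exists (Tvar (Vs s x)). Qed.

Lemma term_pullback G D (h : env M G -> env M D) : tmap h ->
  forall s (t : term D s), exists t' : term G s,
    forall e, teval e t' = teval (h e) t.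
Proof.
move=> Hh; suff [] : (forall s (t : term D s), exists t' : term G s,
    forall e : env M G, teval e t' = teval (h e) t) /\
  (forall E (ts : terms D E), exists ts' : terms G E,
    forall e : env M G, tseval e ts' = tseval (h e) ts) by [].
apply: term_mutind => //=.
- by move=> s x; exact: tmap_lookup.
- by move=> f ts [ts' H]; exists (Tapp ts') => e /=; rewrite H.
- by exists (Tnil G).
- move=> s E t [t' Ht] ts [ts' Hts]; exists (Tcons t' ts') => e /=.
  by rewrite Ht Hts.
Qed.

Lemma tmap_terms G D (h : env M G -> env M D) : tmap h ->
  exists ts : terms G D, forall e, tseval e ts = h e.
Proof.
elim: D h => [|s D IH] h /=; first by exists (Tnil G) => e; case: (h e).
move=> [[t Ht] /IH[ts Hts]]; exists (Tcons t ts) => e /=.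
by rewrite Ht Hts; case: (h e).
Qed.

Lemma tmap_comp G D P (h : env M G -> env M D) (k : env M D -> env M P) :
  tmap h -> tmap k -> tmap (k \o h).
Proof.
move=> Hh; elim: P k => [|s P IH] //= k [[t Ht] Hk]; split.
  have [t' Ht'] := term_pullback Hh t.
  by exists t' => e; rewrite Ht' Ht.
exact: (IH (fun e => (k e).2)).
Qed.

Lemma tmap_cat G D P (h : env M G -> env M D) (k : env M G -> env M P) :
  tmap h -> tmap k -> tmap (fun e => ecat (h e) (k e)).
Proof.
by move=> + Hk; elim: D h => [|s D IH] //= h [Ht Hh]; split=> //; exact: IH.
Qed.

Lemma tmap_take G D : tmap (@etake _ M G D).
Proof.
elim: G => [|s G IH] //=; split; first by exists (Tvar (Vz s (G ++ D))).
exact: (tmap_comp (tmap_tail s (G ++ D)) IH).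
Qed.

Lemma tmap_drop G D : tmap (@edrop _ M G D).
Proof.
elim: G => [|s G IH] /=; first exact: tmap_id.
exact: (tmap_comp (tmap_tail s (G ++ D)) IH).
Qed.

End TermMaps.

(** * Definable sets *)

Section ZeroDefinable.
Variables (L : language) (M : structure L).
Implicit Types G D P : seq (lsort L).

(** Definability without parameters, as a property of sets of tuples: logical operations then become
    set operations, and equivalent formulas need not be told apart. *)
Definition zdef G (X : set (env M G)) :=
  exists phi : formula G, forall e, sat phi e <-> X e.

(** The substitution lemma for formulas. The induction keeps [G] and [h] general, because a
    quantifier adds a variable to both. *)
Lemma zdef_preim G D (h : env M G -> env M D) (X : set (env M D)) :
  tmap h -> zdef X -> zdef (h @^-1` X).
Proof.
move=> Hh [phi HX]; suff [psi Hpsi] : exists psi : formula G,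
    forall e, sat psi e <-> sat phi (h e).
  by exists psi => e; rewrite Hpsi HX.
elim: phi G h Hh {X HX} => {D}.
- move=> D s t u G h Hh.
  have [t' Ht] := term_pullback Hh t; have [u' Hu] := term_pullback Hh u.
  by exists (Feq t' u') => e /=; rewrite Ht Hu.
- move=> D r ts G h Hh.
  have [us Hus] : exists us : terms G (rdom r),
      forall e, tseval e us = tseval (h e) ts.
    elim: ts => [|s E t ts [us Hus]]; first by exists (Tnil G).
    have [t' Ht] := term_pullback Hh t.
    by exists (Tcons t' us) => e /=; rewrite Ht Hus.
  by exists (Frel us) => e /=; rewrite Hus.
- by move=> D G h _; exists (Fbot G).
- move=> D phi IH1 psi IH2 G h Hh.
  have [phi' H1] := IH1 _ _ Hh; have [psi' H2] := IH2 _ _ Hh.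
  by exists (Fimp phi' psi') => e /=; rewrite H1 H2.
- move=> D s phi IH G h Hh.
  (* Under the quantifier, [h] is extended by the identity on the bound variable. *)
  have [|phi' H] := IH (s :: G) (fun e => (e.1, h e.2)).
    split; first by exists (Tvar (Vz s G)).
    exact: (tmap_comp (tmap_tail M s G) Hh).
  by exists (Fall phi') => e /=; split=> H' x; apply/(H (x, e))/H'.
Qed.

Lemma zdef_imp G (X Y : set (env M G)) :
  zdef X -> zdef Y -> zdef [set e | X e -> Y e].
Proof.
by move=> [f Hf] [g Hg]; exists (Fimp f g) => e /=; rewrite Hf Hg.
Qed.

Lemma zdef0 G : zdef (@set0 (env M G)).
Proof. by exists (Fbot G). Qed.

Lemma zdefC G (X : set (env M G)) : zdef X -> zdef (~` X).
Proof. by move=> HX; exact: (zdef_imp HX (@zdef0 G)). Qed.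

Lemma zdefT G : zdef (@setT (env M G)).
Proof. by rewrite -setC0; exact/zdefC/zdef0. Qed.

Lemma zdefI G (X Y : set (env M G)) : zdef X -> zdef Y -> zdef (X `&` Y).
Proof.
move=> HX HY; have /zdefC := zdef_imp HX (zdefC HY).
congr zdef; apply/seteqP; split=> e /=; last tauto.
by move=> /not_implyP[? /contrapT].
Qed.

Lemma zdef_all D G (X : set (env M (D ++ G))) :
  zdef X -> zdef [set e | forall d, X (ecat d e)].
Proof.
elim: D X => [|s D IH] X /=.
  by congr zdef; apply/seteqP; split=> e /= => [|/(_ tt)].
move=> [phi Hphi].
have /IH[psi Hpsi] : zdef [set e : env M (D ++ G) | forall x, X (x, e)].
  by exists (Fall phi) => e /=; split=> H x; apply/Hphi/H.
exists psi => e; rewrite Hpsi /=; split=> [H [x d] /=|H d x]; first exact: H.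
exact: (H (x, d)).
Qed.

Lemma zdef_ex D G (X : set (env M (D ++ G))) :
  zdef X -> zdef [set e | exists d, X (ecat d e)].
Proof.
move=> /zdefC/zdef_all/zdefC; congr zdef; apply/seteqP; split=> e /=.
  by move=> /existsNP[d /contrapT]; exists d.
by move=> [d Xd] /(_ d).
Qed.

Lemma zdef_eq G D (h k : env M G -> env M D) :
  tmap h -> tmap k -> zdef [set e | h e = k e].
Proof.
elim: D h k => [|s D IH] h k /=.
  move=> _ _; have := @zdefT G; congr zdef; apply/seteqP; split=> e //= _.
  by case: (h e) (k e) => [] [].
move=> [[t Ht] Hh] [[u Hu] Hk].
have X1 : zdef [set e | (h e).1 = (k e).1].
  by exists (Feq t u) => e /=; rewrite Ht Hu.
have := zdefI X1 (IH _ _ Hh Hk); congr zdef; apply/seteqP; split=> e /=.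
  by case: (h e) (k e) => [x a] [y b] /= [-> ->].
by move=> ->.
Qed.

End ZeroDefinable.

Lemma elems_lookup (S : Type) (C : S -> Type) (G : seq S) (a : env C G)
    (u : {s : S & C s}) :
  elems a u -> exists v : var G (projT1 u), elookup v a = projT2 u.
Proof.
elim: G a => [|s G IH] //= [x a] /= [->|/IH[v Hv]]; first by exists (Vz s G).
by exists (Vs s v).
Qed.

Section TermMapsComposed.
Variables (L : language) (M : structure L).
Implicit Types G D P : seq (lsort L).

Lemma tmap_app G D P (k : env M D -> env M P) (h : env M G -> env M D) :
  tmap k -> tmap h -> tmap (fun e => k (h e)).
Proof. by move=> Hk Hh; exact: (tmap_comp Hh Hk). Qed.

Lemma tmap_takeF G D P (h : env M G -> env M (D ++ P)) :
  tmap h -> tmap (fun e => etake (h e)).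
Proof. exact/tmap_app/tmap_take. Qed.

Lemma tmap_dropF G D P (h : env M G -> env M (D ++ P)) :
  tmap h -> tmap (fun e => edrop (h e)).
Proof. exact/tmap_app/tmap_drop. Qed.

End TermMapsComposed.

Ltac solve_tmap := repeat first
  [ assumption | exact: tmap_id | apply: tmap_cat | apply: tmap_takeF
  | apply: tmap_dropF ].

(** * Definability over a parameter set *)

Section Definable.
Variables (L : language) (M : structure L).
Implicit Types (A B : set {s : lsort L & M s}) (G D P : seq (lsort L)).

Lemma definableP A G (X : set (env M G)) : definable A X <->
  exists P (c : env M P) (Z : set (env M (G ++ P))),
    [/\ elems c `<=` A, zdef Z & X = [set x | Z (ecat x c)]].
Proof.
split=> [[[P f c] Ac ->]|[P [c [Z [Ac [f Hf] ->]]]]].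
  by exists P, c, (sat f); split=> //; exists f.
by exists (PFormula f c) => //; apply/seteqP; split=> x; rewrite /psat /= Hf.
Qed.

Lemma definable_sub A B G (X : set (env M G)) :
  A `<=` B -> definable A X -> definable B X.
Proof. by move=> AB [f Af ->]; exists f => //; exact: subset_trans Af AB. Qed.

Lemma zdef_definable A G (X : set (env M G)) : zdef X -> definable A X.
Proof.
move=> HX; apply/definableP; exists [::], tt, (@etake _ M G [::] @^-1` X).
split=> //; first exact: zdef_preim (tmap_take M G [::]) HX.
by apply/seteqP; split=> x /=; rewrite etakeK.
Qed.

Lemma definableC A G (X : set (env M G)) : definable A X -> definable A (~` X).
Proof. by move=> [f Af ->]; exists (pneg f). Qed.

Lemma definable_preim A G D (h : env M G -> env M D) (X : set (env M D)) :
  tmap h -> definable A X -> definable A (h @^-1` X).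
Proof.
move=> Hh /definableP[P [c [Z [Ac HZ ->]]]]; apply/definableP.
exists P, c, ((fun e => ecat (h (etake e)) (edrop e)) @^-1` Z); split=> //.
  apply: zdef_preim HZ; apply: tmap_cat; last exact: tmap_drop.
  exact/(tmap_app Hh)/tmap_take.
by apply/seteqP; split=> x /=; rewrite etakeK edropK.
Qed.

Lemma definableI A G (X Y : set (env M G)) :
  definable A X -> definable A Y -> definable A (X `&` Y).
Proof.
move=> /definableP[P [c [Z [Ac HZ ->]]]] /definableP[Q [d [W [Ad HW ->]]]].
apply/definableP; exists (P ++ Q), (ecat c d).
exists ((fun e => ecat (etake e) (etake (edrop e))) @^-1` Z `&`
        (fun e => ecat (etake e) (edrop (edrop e))) @^-1` W); split.
- by rewrite elems_ecat subUset.
- apply: zdefI; [apply: zdef_preim HZ|apply: zdef_preim HW]; solve_tmap.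
- by apply/seteqP; split=> x /=; rewrite ?(etakeK, edropK).
Qed.

Lemma definableT A G : definable A (@setT (env M G)).
Proof. exact/zdef_definable/zdefT. Qed.

Lemma definable_eq A G D (h k : env M G -> env M D) :
  tmap h -> tmap k -> definable A [set e | h e = k e].
Proof. by move=> Hh Hk; exact/zdef_definable/zdef_eq. Qed.

Lemma definable_ex A G D (X : set (env M (G ++ D))) :
  definable A X -> definable A [set x | exists y, X (ecat x y)].
Proof.
move=> /definableP[P [c [Z [Ac HZ ->]]]]; apply/definableP; exists P, c.
exists [set e | exists y : env M D,
  ((fun e => ecat (ecat (etake (edrop e)) (etake e)) (edrop (edrop e))) @^-1` Z)
  (ecat y e)]; split=> //.
  apply: zdef_ex; apply: zdef_preim HZ; solve_tmap.
by apply/seteqP; split=> x /= [y Hy]; exists y;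
  move: Hy; rewrite !(etakeK, edropK).
Qed.

(** Each entry of [c] either lies in [A] and is kept as a parameter, or is an entry of [a] and is
    read off by a variable. *)
Lemma params_in_adjoin A G P (a : env M G) (c : env M P) :
  elems c `<=` adjoin A a ->
  exists P' (c' : env M P') (k : env M (G ++ P') -> env M P),
    [/\ elems c' `<=` A, tmap k & c = k (ecat a c')].
Proof.
elim: P c => [|s P IH] /= c.
  by exists [::], tt, (fun=> tt); split=> //; case: (c).
case: c => x c /=; rewrite subUset => -[/(_ _ erefl) Hx].
move=> /IH[P' [c' [k [Ac' Hk ->]]]]; case: Hx => [Ax|/elems_lookup[v /= Hv]].
  exists (s :: P'), (x, c').
  pose tl (e : env M (G ++ s :: P')) : env M (s :: P') := edrop e.
  exists (fun e => ((tl e).1, k (ecat (etake e) (tl e).2))); split=> /=.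
  - by rewrite subUset; split=> // _ ->.
  - split; first exact: (tmap_lookup (tmap_drop M G (s :: P')) (Vz s P')).
    apply: (tmap_app Hk); apply: tmap_cat; first exact: tmap_take.
    exact/(tmap_app (tmap_tail M s P'))/tmap_drop.
  - by rewrite /tl etakeK edropK.
exists P', c', (fun e => (elookup v (etake e), k e)); split=> //=.
  by split=> //; exact: (tmap_lookup (tmap_take M G P')).
by rewrite etakeK Hv.
Qed.

(** Trades the parameters [a] for variables, so that types over [adjoin A a] can be studied as types
    over [A] of longer tuples. *)
Lemma definable_adjoin A G D (a : env M G) (Y : set (env M D)) :
  definable (adjoin A a) Y <->
  exists2 X : set (env M (G ++ D)), definable A X & Y = [set y | X (ecat a y)].
Proof.
split=> [/definableP[P [c [Z [Ac HZ ->]]]]|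
    [X /definableP[P [c [Z [Ac HZ ->]]]] ->]].
  have [P' [c' [k [Ac' Hk ->]]]] := params_in_adjoin Ac.
  exists [set e | Z (ecat (edrop e) (k (ecat (etake e) c')))]; last first.
    by apply/seteqP; split=> x /=; rewrite etakeK edropK.
  apply/definableP; exists P', c', ((fun e => ecat (edrop (etake e))
    (k (ecat (etake (etake e)) (edrop e)))) @^-1` Z); split=> //.
    apply: zdef_preim HZ; apply: tmap_cat; first by solve_tmap.
    by apply: (tmap_app Hk); solve_tmap.
  by apply/seteqP; split=> e /=; rewrite etakeK edropK.
apply/definableP; exists (G ++ P), (ecat a c).
exists ((fun e => ecat (ecat (etake (edrop e)) (etake e)) (edrop (edrop e)))
  @^-1` Z); split.
- rewrite elems_ecat subUset; split; first exact: subsetUr.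
  by apply: (subset_trans Ac); exact: subsetUl.
- by apply: zdef_preim HZ; solve_tmap.
- by apply/seteqP; split=> e /=; rewrite !(etakeK, edropK).
Qed.

End Definable.

(** * Compactness and types *)

Section Compactness.
Variables (L : language) (M : structure L).
Implicit Types (A B : set {s : lsort L & M s}) (G D P : seq (lsort L)).

(** Compactness for families closed under binary intersection. In this form it passes to M^eq by
    taking preimages. *)
Definition compact_over A := forall G (F : set (set (env M G))),
  F setT -> (forall X Y, F X -> F Y -> F (X `&` Y)) ->
  (forall X, F X -> definable A X) -> (forall X, F X -> X !=set0) ->
  exists x, forall X, F X -> X x.

(** An ultrafilter containing [F] selects a complete type over [A]. It is finitely satisfiable
    because finite intersections of members of the ultrafilter are non-empty, and saturation
    realizes it. *)
Lemma saturated_compact (K : Type) A :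
  saturated M K -> small K A -> compact_over A.
Proof.
move=> Hsat HA G F FT FI FA F0.
have PF : ProperFilter (filter_from F id).
  apply: filter_from_proper F0; apply: filter_from_filter; first by exists setT.
  by move=> X Y FX FY; exists (X `&` Y) => //; exact: FI.
have [U [UU FU]] := ultraFilterLemma PF.
pose p := [set f : pformula M G | params_in A f /\ U (psat f)].
have [|x px] := Hsat _ HA G p.
- split=> [f []//||f Af]; last first.
    have [Uf|Uf] := in_ultra_setVsetC (psat f) UU; [by left|right].
    by split.
  move=> q qp fq; suff /filter_ex : U (realizations q) by [].
  have /(@finite_seqP {classic pformula M G})[s qs] := fq.
  have : forall f, f \in s -> U (psat f).
    by move=> f fs; have [] // := qp f; rewrite qs.
  rewrite qs => {qs}; elim: s => [|f s IH] Us.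
    by apply: (filterS _ filterT) => x _ f.
  have : U (psat f `&` realizations [set` s]).
    apply: filterI; first by apply: Us; rewrite mem_head.
    by apply: IH => g gs; apply: Us; rewrite inE gs orbT.
  apply: filterS => x [fx sx] g /=; rewrite inE => /orP[/eqP->//|gs].
  exact: sx.
- exists x => X FX; have [f Af Xf] := FA X FX.
  rewrite Xf; apply: px; split=> //; rewrite -Xf.
  by apply: FU; exists X.
Qed.

End Compactness.

(** * Equality of types over a parameter set *)

Section EqualTypes.
Variables (L : language) (M : structure L) (A : set {s : lsort L & M s}).
Implicit Types (G D P : seq (lsort L)).

(** One implication suffices for equality of types, since complements of definable sets are
    definable. *)
Definition eqtp G (a b : env M G) :=
  forall X, definable A X -> X a -> X b.

Lemma eqtp_sym G (a b : env M G) : eqtp a b -> eqtp b a.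
Proof.
move=> ab X AX Xb; apply: contrapT => Xa.
exact: (ab _ (definableC AX) Xa Xb).
Qed.

Lemma eqtp_trans G (a b c : env M G) : eqtp a b -> eqtp b c -> eqtp a c.
Proof. by move=> ab bc X AX Xa; exact: (bc _ AX (ab _ AX Xa)). Qed.

Lemma eqtp_realizations G (a b : env M G) :
  realizations (tp a A) b <-> eqtp a b.
Proof.
split=> [H X [f Af ->] fa|H f [Af fa]]; first exact: H.
by apply: (H (psat f)) => //; exists f.
Qed.

Lemma eq_tp G (a b : env M G) : tp a A = tp b A <-> eqtp a b.
Proof.
split=> [E|E]; first by apply/eqtp_realizations; rewrite E => f [].
apply/seteqP; split=> f [Af fx]; split=> //.
  by apply: (E (psat f)) => //; exists f.
by apply: (eqtp_sym E) fx; exists f.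
Qed.

Lemma eqtp_tmap G D (h : env M G -> env M D) (a b : env M G) :
  tmap h -> eqtp a b -> eqtp (h a) (h b).
Proof. by move=> Hh ab X AX; exact: (ab _ (definable_preim Hh AX)). Qed.

Lemma eqtp_take G D (a a' : env M G) (b b' : env M D) :
  eqtp (ecat a b) (ecat a' b') -> eqtp a a'.
Proof. by move/(eqtp_tmap (tmap_take M G D)); rewrite !etakeK. Qed.

Lemma eqtp_drop G D (a a' : env M G) (b b' : env M D) :
  eqtp (ecat a b) (ecat a' b') -> eqtp b b'.
Proof. by move/(eqtp_tmap (tmap_drop M G D)); rewrite !edropK. Qed.

Lemma eqtp_swap G D (a a' : env M G) (b b' : env M D) :
  eqtp (ecat a b) (ecat a' b') -> eqtp (ecat b a) (ecat b' a').
Proof.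
have H : tmap (fun e : env M (G ++ D) => ecat (edrop e) (etake e)).
  by solve_tmap.
by move/(eqtp_tmap H); rewrite !(etakeK, edropK).
Qed.

Lemma eqtp_adjoin G D (a : env M G) (b b' : env M D) :
  realizations (tp b (adjoin A a)) b' <-> eqtp (ecat a b) (ecat a b').
Proof.
split=> [H X AX Xb|H f [Af fb]].
  have [f Af Xf] : definable (adjoin A a) [set y | X (ecat a y)].
    by apply/definable_adjoin; exists X.
  have := H f; rewrite -/([set y | X (ecat a y)] b') Xf; apply; split=> //.
  by rewrite -Xf.
have [X AX fX] : exists2 X : set (env M (G ++ D)),
    definable A X & psat f = [set y | X (ecat a y)].
  by apply/definable_adjoin; exists f.
by move: fb; rewrite fX /=; exact: H.
Qed.

Lemma complete_type_eqtp G (p : set (pformula M G)) (a b : env M G) :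
  complete_type A p -> realizations p a -> realizations p b -> eqtp a b.
Proof.
move=> [_ _ Hp] pa pb X [f Af ->] fa.
by have [/pb|/pa/(_ fa)] := Hp f Af.
Qed.

Lemma type_definable_eqtp G (X : set (env M G)) (a b : env M G) :
  type_definable A X -> eqtp a b -> X a -> X b.
Proof.
move=> [p pA ->] ab pa f pf; apply: (ab (psat f)) (pa _ pf).
by exists f => //; exact: pA.
Qed.

Lemma complete_tp G (a : env M G) : complete_type A (tp a A).
Proof.
split=> [f []//|q qp _|f Af]; first by exists a => f /qp [].
by have [fa|fa] := EM (psat f a); [left|right].
Qed.

Lemma type_definable_bigcap G (X : set (env M G)) :
  (forall x, ~ X x -> exists2 Y, definable A Y & X `<=` Y /\ ~ Y x) ->
  type_definable A X.
Proof.
move=> H; exists [set f | params_in A f /\ X `<=` psat f]; first by move=> f [].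
apply/seteqP; split=> x; first by move=> Xx f [_]; exact.
move=> Hx; apply: contrapT => /H[_ [f Af ->] [Xf]]; apply.
exact: Hx.
Qed.

Hypothesis compactA : forall G (a : env M G), compact_over (adjoin A a).

(** The back-and-forth step. For each definable [X] containing [ecat a b], the tuple [a] lies in the
    projection of [X], hence so does [a']; compactness over [adjoin A a'] finds one [b'] for all
    [X]. *)
Lemma eqtp_extend G D (a a' : env M G) (b : env M D) :
  eqtp a a' -> exists b', eqtp (ecat a b) (ecat a' b').
Proof.
move=> aa'.
pose F := [set Y : set (env M D) | exists2 X : set (env M (G ++ D)),
  definable A X & X (ecat a b) /\ Y = [set y | X (ecat a' y)]].
have [||||b' Hb'] := @compactA _ a' _ F.
- by exists setT; [exact: definableT|split].
- move=> _ _ [X AX [Xb ->]] [Y AY [Yb ->]]; exists (X `&` Y) => //.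
  exact: definableI.
- by move=> _ [X AX [Xb ->]]; apply/definable_adjoin; exists X.
- move=> _ [X AX [Xb ->]]; apply: (aa' _ (definable_ex AX)).
  by exists b.
by exists b' => X AX Xb; apply: (Hb' [set y | X (ecat a' y)]); exists X.
Qed.

End EqualTypes.

(** * Counting realizations *)

Section Counting.

Lemma ncard_eq (U : Type) (X : set U) n : X #= `I_n -> ncard X = n.
Proof.
move=> Xn; rewrite /ncard; have : [set m | X #= `I_m] n by [].
move=> /(xgetI 0%N) /= Xm; apply/card_eq_II.
by rewrite (card_eql Xm) in Xn.
Qed.

Lemma ncardP (U : Type) (X : set U) : finite_set X -> X #= `I_(ncard X).
Proof. by move=> /finite_setP[n Xn]; rewrite (ncard_eq Xn). Qed.

Lemma card_eq_count (T : choiceType) (s : seq T) (p : pred T) :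
  uniq s -> [set x | x \in s /\ p x] #= `I_(count p s).
Proof.
move=> us; have : [set` [fset x in [seq x <- s | p x]]%fset] #= `I_(count p s).
  by apply/card_eq_fsetP; rewrite card_fseq undup_id ?filter_uniq// size_filter.
congr (_ #= _); apply/seteqP; split=> x /=; rewrite inE mem_filter.
  by move=> /andP[].
by move=> [-> ->].
Qed.

(** Duplicate-free lists are what back-and-forth can transport, so cardinalities are compared
    through them. An infinite set contains lists of length [n.+1]. *)
Lemma card_le_seqP (T : choiceType) (X : set T) n :
  X #<= `I_n <-> forall s : seq T, uniq s -> [set` s] `<=` X -> size s <= n.
Proof.
split=> [Xn s us sX|H].
  rewrite -card_le_II.
  apply: card_le_trans (card_le_trans (subset_card_le sX) Xn).
  have : [set` s] #= `I_(size s).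
    by have := card_eq_count predT us; rewrite count_predT;
      congr (_ #= _); apply/seteqP; split=> x /= [].
  by rewrite card_eq_le => /andP[].
have [Xf|/infinite_set_fset Xi] := pselect (finite_set X).
  have /finite_setP[m Xm] := Xf.
  rewrite (card_le_eql Xm) card_le_II -(card_fset_set Xm).
  apply: H; first exact: fset_uniq.
  by move=> x /=; rewrite in_fset_set// => /set_mem.
have [F FX] := Xi n.+1; rewrite ltnNge H//; exact: fset_uniq.
Qed.

Lemma card_eq_seq (T : choiceType) (X : set T) n : X #= `I_n ->
  exists2 s : seq T, uniq s & size s = n /\ [set` s] = X.
Proof.
move=> Xn; have Xf : finite_set X by apply/finite_setP; exists n.
exists (fset_set X); first exact: fset_uniq.
split; first exact: (card_fset_set Xn).
apply/seteqP; split=> x /=; rewrite in_fset_set//; first exact: set_mem.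
exact: mem_set.
Qed.

Import GRing.Theory Num.Theory.

(* Each side is the sum of [w p / count (r p) t] over the pairs with [r p q]. *)
Lemma weighted_double_count (T : eqType) (s t : seq T) (r : rel T)
    (w v : T -> nat) :
  {in s, forall p, has (r p) t} -> {in t, forall q, has (r^~ q) s} ->
  {in s & t, forall p q, r p q ->
    w p = v q /\ count (r p) t = count (r^~ q) s} ->
  \sum_(p <- s) w p = \sum_(q <- t) v q.
Proof.
move=> Hs Ht Hr; apply/eqP; rewrite -(eqr_nat rat) !natr_sum; apply/eqP.
transitivity (\sum_(p <- s) \sum_(q <- t | r p q)
    ((w p)%:R / (count (r p) t)%:R : rat))%R.
  rewrite !big_seq; apply: eq_bigr => p ps; rewrite big_const_seq.
  rewrite iter_addr_0 -[RHS]mulr_natr divfK// pnatr_eq0 -lt0n -has_count.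
  exact: Hs.
transitivity (\sum_(q <- t) \sum_(p <- s | r p q)
    ((v q)%:R / (count (r^~ q) s)%:R : rat))%R; last first.
  rewrite !big_seq; apply: eq_bigr => q qt; rewrite big_const_seq.
  rewrite iter_addr_0 -[LHS]mulr_natr divfK// pnatr_eq0 -lt0n -has_count.
  exact: Ht.
under eq_bigr do rewrite big_mkcond; rewrite exchange_big /=.
rewrite big_seq [RHS]big_seq; apply: eq_bigr => q qt.
rewrite [RHS]big_mkcond big_seq [RHS]big_seq; apply: eq_bigr => p ps.
by case: ifP => // rpq; have [-> ->] := Hr _ _ ps qt rpq.
Qed.

End Counting.

(** * Algebraicity and fibres of invariant relations *)

Section Fibres.
Variables (L : language) (N : structure L) (A : set {s : lsort L & N s}).
Implicit Types (G D P : seq (lsort L)).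

Lemma adjoin_ecat G D (a : env N G) (b : env N D) :
  adjoin (adjoin A a) b = adjoin A (ecat a b).
Proof. by rewrite /adjoin elems_ecat setUA. Qed.

Lemma definable_seq D (s : seq {classic env N D}) :
  exists P (c : env N P), definable (adjoin A c) [set` s].
Proof.
elim: s => [|y s [P [c Hs]]].
  exists [::], tt; rewrite set_nil -setCT; exact/definableC/definableT.
exists (D ++ P), (ecat y c).
have Hy : definable (adjoin A (ecat y c)) [set y].
  apply: (@definable_sub _ _ (adjoin A y)).
    by rewrite -adjoin_ecat; exact: subsetUl.
  apply/definable_adjoin; exists [set e | etake e = edrop e].
    by apply: definable_eq; [exact: tmap_take|exact: tmap_drop].
  by apply/seteqP; split=> e /=; rewrite etakeK edropK => ->.
have {}Hs : definable (adjoin A (ecat y c)) [set` s].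
  apply: definable_sub Hs; rewrite /adjoin elems_ecat.
  by move=> u [Au|cu]; [left|right; right].
have := definableC (definableI (definableC Hy) (definableC Hs)).
rewrite -setCU setCK; congr definable; apply/seteqP; split=> x /=.
  by rewrite inE => -[->|->]; rewrite ?eqxx ?orbT.
by rewrite inE => /orP[/eqP->|->]; [left|right].
Qed.

(** Follows from type-definability over [A], and is the property under which fibres are transported
    along [eqtp]. *)
Definition tp_invariant G (C : set (env N G)) :=
  forall a b, eqtp A a b -> C a -> C b.

Hypothesis compactA : forall G (a : env N G), compact_over (adjoin A a).

(** If [b] is not algebraic, no definable set over [adjoin A a] containing [b] is included in the
    finite set of realizations of its type. Compactness then yields a further realization outside
    that set, a contradiction. *)
Lemma acl_adjoinP G D (a : env N G) (b : env N D) :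
  acl (adjoin A a) b <-> finite_set [set y | eqtp A (ecat a b) (ecat a y)].
Proof.
split=> [[X [AX Xf Xb]]|Sf].
  apply: sub_finite_set Xf => y aby.
  have /eqtp_realizations H : realizations (tp b (adjoin A a)) y.
    exact/eqtp_adjoin.
  exact: H.
apply: contrapT => nacl.
have /(@finite_seqP {classic env N D})[s Es] := Sf.
have [P [c Hs]] := definable_seq s.
have Bsub : adjoin A a `<=` adjoin A (ecat a c).
  by rewrite -adjoin_ecat; exact: subsetUl.
have {}Hs : definable (adjoin A (ecat a c)) [set` s].
  apply: definable_sub Hs; rewrite /adjoin elems_ecat.
  by move=> u [Au|cu]; [left|right; right].
(* Both [X] and [X] minus the list [s] are included, which makes the family closed under
   intersection. The tuple [c] supplies the parameters defining [s]. *)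
pose F := [set Y : set (env N D) | exists2 X, definable (adjoin A a) X &
   X b /\ ((Y = X) \/ Y = X `\` [set` s])].
have [||||y Fy] := @compactA _ (ecat a c) _ F.
- by exists setT; [exact: definableT|split=> //; left].
- move=> X0 Y0 [X AX [Xb HX]] [Y AY [Yb HY]]; exists (X `&` Y).
    exact: definableI.
  split=> //; case: HX HY => [->|->] [->|->]; [left => //|right..];
    apply/seteqP; split=> x /=; tauto.
- move=> Y [X /(definable_sub Bsub) AX [Xb [->|->]]] //.
  by apply: definableI => //; exact: definableC.
- move=> Y [X AX [Xb [->|->]]]; first by exists b.
  apply: contrapT => H; apply: nacl; exists (X `&` [set` s]); split.
  + suff -> : X `&` [set` s] = X by [].
    apply/seteqP; split=> [x []//|x Xx]; split=> //; apply: contrapT => sx.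
    by apply: H; exists x.
  + by apply: sub_finite_set Sf; rewrite Es => x [].
  + by split=> //; rewrite -Es.
have ys : ~ [set` s] y.
  have [] // : (setT `\` [set` s]) y.
  by apply: Fy; exists setT; [exact: definableT|split=> //; right].
apply: ys; rewrite -Es /=; apply/eqtp_adjoin/eqtp_realizations => X AX Xb.
by apply: Fy; exists X => //; split=> //; left.
Qed.

(* A list of distinct realizations moves along one entry at a time, the entries
   already moved being added to [a] and [a']. *)
Lemma eqtp_uniq_seq G D (a a' : env N G) (s : seq {classic env N D}) :
  eqtp A a a' -> uniq s ->
  exists2 s' : seq {classic env N D}, uniq s' & size s' = size s /\
    forall y', y' \in s' -> exists2 y, y \in s & eqtp A (ecat a y) (ecat a' y').
Proof.
elim: s G a a' => [|d s IH] G a a' aa' /=; first by exists [::].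
move=> /andP[ds us]; have [d' dd'] := eqtp_extend compactA d aa'.
have [s' us' [ss' Hs']] := IH _ _ _ dd' us.
exists (d' :: s') => /=; last first.
  rewrite ss'; split=> // y'; rewrite inE => /orP[/eqP->|/Hs'[y ys yy']].
    by exists d; rewrite ?mem_head.
  exists y; first by rewrite inE ys orbT.
  have H : tmap (fun e : env N ((G ++ D) ++ D) =>
      ecat (etake (etake e)) (edrop e)) by solve_tmap.
  by move/(eqtp_tmap H): yy'; rewrite !(etakeK, edropK).
rewrite us' andbT; apply/negP => /Hs'[y ys yd].
(* Distinctness survives because equality of the last two blocks of variables is definable. *)
suff yed : y = d by rewrite -yed ys in ds.
have H : definable A
    [set e : env N ((G ++ D) ++ D) | edrop e = edrop (etake e)].
  by apply: definable_eq; solve_tmap.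
by move/eqtp_sym: yd => /(_ _ H) /=; rewrite !(etakeK, edropK); exact.
Qed.

(** A duplicate-free list in the fibre over [a'] moves to one of the same length in the fibre over
    [a]. *)
Lemma fibre_card_le G D (C : set (env N (G ++ D))) (a a' : env N G) n :
  tp_invariant C -> eqtp A a a' ->
  [set y | C (ecat a y)] #<= `I_n -> [set y | C (ecat a' y)] #<= `I_n.
Proof.
move=> HC aa' /(@card_le_seqP {classic env N D}) Ha.
apply/(@card_le_seqP {classic env N D}) => s us sC.
have [s' us' [<- Hs']] := eqtp_uniq_seq (eqtp_sym aa') us.
apply: Ha => // y' /Hs'[y /sC Cy /HC]; exact.
Qed.

Lemma fibre_card G D (C : set (env N (G ++ D))) (a a' : env N G) n :
  tp_invariant C -> eqtp A a a' ->
  [set y | C (ecat a y)] #= `I_n -> [set y | C (ecat a' y)] #= `I_n.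
Proof.
move=> HC aa' Ca; have Cle : [set y | C (ecat a y)] #<= `I_n.
  by rewrite (card_le_eql Ca) card_lexx.
have Cle' := fibre_card_le HC aa' Cle.
have /finite_setP[m Cm] : finite_set [set y | C (ecat a' y)].
  by apply/finite_set_leP; exists n.
suff -> : n = m by [].
apply/eqP; rewrite eqn_leq -!card_le_II -(card_le_eql Cm) Cle' andbT.
rewrite -(card_le_eql Ca); apply: (fibre_card_le HC (eqtp_sym aa')).
by rewrite (card_le_eql Cm) card_lexx.
Qed.

Lemma fibre_finite G D (C : set (env N (G ++ D))) (a a' : env N G) :
  tp_invariant C -> eqtp A a a' ->
  finite_set [set y | C (ecat a y)] -> finite_set [set y | C (ecat a' y)].
Proof.
move=> HC aa' /finite_setP[n Cn]; apply/finite_setP; exists n.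
exact: fibre_card aa' Cn.
Qed.

Lemma tp_invariant_eqtp G (e : env N G) : tp_invariant [set e' | eqtp A e e'].
Proof. by move=> a b ab ea; exact: eqtp_trans ea ab. Qed.

Lemma tp_invariant_tmap G D (h : env N G -> env N D) (C : set (env N D)) :
  tmap h -> tp_invariant C -> tp_invariant (h @^-1` C).
Proof. by move=> Hh HC a b /(eqtp_tmap Hh); exact: HC. Qed.

Lemma tp_invariantI G (C D : set (env N G)) :
  tp_invariant C -> tp_invariant D -> tp_invariant (C `&` D).
Proof. by move=> HC HD a b ab [/(HC _ _ ab) ? /(HD _ _ ab)]. Qed.

Lemma tp_invariant_ex G D (C : set (env N (G ++ D))) :
  tp_invariant C -> tp_invariant [set x | exists y, C (ecat x y)].
Proof.
move=> HC a a' aa' [b Cab]; have [b' bb'] := eqtp_extend compactA b aa'.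
by exists b'; exact: HC bb' Cab.
Qed.

Lemma mult_adjoin G D (a : env N G) (b : env N D) :
  acl (adjoin A a) b ->
  [set y | eqtp A (ecat a b) (ecat a y)] #= `I_(mult b (adjoin A a)).
Proof.
move=> /acl_adjoinP; rewrite /mult.
suff -> : [set y | eqtp A (ecat a b) (ecat a y)] =
  realizations (tp b (adjoin A a)) by exact: ncardP.
by apply/seteqP; split=> y /eqtp_adjoin.
Qed.

End Fibres.

(** * The three implications *)

Section Equivalences.
Variables (L : language) (N : structure L) (K : Type).
Implicit Types (A : set {s : lsort L & N s}) (G D P : seq (lsort L)).

Hypothesis compact : forall A, small K A ->
  forall G (a : env N G), compact_over (adjoin A a).

Lemma fibre_lE G D A (p : set (pformula N G)) (q : set (pformula N D))
    C (x : env N G) :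
  correspondence A (realizations p) (realizations q) C ->
  fibre_l (realizations q) C x = [set y | C (ecat x y)].
Proof.
move=> HC; apply/seteqP; split=> y /=; first by case.
by move=> Cxy; split=> //; have [] := corr_sub HC Cxy.
Qed.

Lemma fibre_rE G D A (p : set (pformula N G)) (q : set (pformula N D))
    C (y : env N D) :
  correspondence A (realizations p) (realizations q) C ->
  fibre_r (realizations p) C y = [set x | C (ecat x y)].
Proof.
move=> HC; apply/seteqP; split=> x /=; first by case.
by move=> Cxy; split=> //; have [] := corr_sub HC Cxy.
Qed.

(** The first set has m(b/Aa) elements. The second is a fibre of the swapped relation [C], whose
    fibre over [b] has m(a/Ab) elements; [fibre_card] carries this count from [b] to [a]. The
    finiteness hypotheses give interalgebraicity. *)
Lemma unimodular_pair A G (a b : env N G) :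
  unimodular N K -> small K A -> eqtp A a b ->
  finite_set [set y | eqtp A (ecat a b) (ecat a y)] ->
  finite_set [set x | eqtp A (ecat a b) (ecat x a)] ->
  exists n, [set y | eqtp A (ecat a b) (ecat a y)] #= `I_n /\
            [set x | eqtp A (ecat a b) (ecat x a)] #= `I_n.
Proof.
move=> HU sA ab f1 f2; have cA := compact sA.
pose C := [set e | eqtp A (ecat a b) (ecat (edrop e) (etake e : env N G))].
have HC : tp_invariant A C.
  apply: (tp_invariant_tmap (C := [set e | eqtp A (ecat a b) e])).
    by solve_tmap.
  exact: tp_invariant_eqtp.
have CE (u : env N G) :
    [set x | C (ecat u x)] = [set x | eqtp A (ecat a b) (ecat x u)].
  by apply/seteqP; split=> x; rewrite /C /= etakeK edropK.
have aclb : acl (adjoin A a) b by apply/(acl_adjoinP cA).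
have SE : [set x | C (ecat b x)] = [set x | eqtp A (ecat b a) (ecat b x)].
  by rewrite CE; apply/seteqP; split=> x; exact: eqtp_swap.
have acla : acl (adjoin A b) a.
  apply/(acl_adjoinP cA); rewrite -SE.
  by apply: (fibre_finite cA HC ab); rewrite CE.
exists (mult b (adjoin A a)); split; first exact: (mult_adjoin cA).
rewrite -(HU A G a b sA)//; last by apply/eq_tp.
rewrite -CE; apply: (fibre_card cA HC (eqtp_sym ab)); rewrite SE.
exact: (mult_adjoin cA).
Qed.

(** Counts the pairs (z, y) with C1(x, y) and C2(z, y) in the other order: each [y] in [bs] has
    exactly [l2] partners [z]. *)
Lemma sum_fibres A G D (p : set (pformula N G)) (q : set (pformula N D))
    (C1 C2 : set (env N (G ++ D))) (k1 l2 : nat)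
    (x : env N G) (bs : seq {classic env N D}) (zs : seq {classic env N G}) :
  correspondence A (realizations p) (realizations q) C1 ->
  correspondence A (realizations p) (realizations q) C2 ->
  uniform (realizations p) (realizations q) C2 k1 l2 ->
  [set` bs] = [set y | C1 (ecat x y)] -> uniq zs ->
  [set` zs] = [set z | exists y, C1 (ecat x y) /\ C2 (ecat z y)] ->
  \sum_(z <- zs) count (fun y : {classic env N D} => `[< C2 (ecat z y) >]) bs =
  size bs * l2.
Proof.
move=> HC1 HC2 [_ U2] Ebs uzs Ezs.
under eq_bigr do rewrite -sum1_count big_mkcond; rewrite exchange_big /=.
rewrite -[size bs]sum1_size big_distrl /= big_seq [RHS]big_seq.
apply: eq_bigr => y ybs.
rewrite -big_mkcond sum1_count mul1n; apply/esym/card_eq_II.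
have C1y : C1 (ecat x y) by have : [set` bs] y by []; rewrite Ebs.
have [_ /U2] := corr_sub HC1 C1y; rewrite (fibre_rE _ HC2) => Hl.
have := card_eq_count (fun z : {classic env N G} => `[< C2 (ecat z y) >]) uzs.
(* Membership in [zs] is automatic for such [z], with [y] as witness. *)
rewrite (_ : [set z | _ /\ _] = [set z | C2 (ecat z y)]).
  by move=> Hn; rewrite -(card_eql Hl).
apply/seteqP; split=> z /=; first by move=> [_ /asboolP].
move=> C2z; split; last exact/asboolP.
have : [set` zs] z by rewrite Ezs; exists y.
by [].
Qed.


Lemma ratio_eq (k1 l1 k2 l2 : nat) : 0 < l1 -> 0 < l2 ->
  k1 * l2 = k2 * l1 -> ratio k1 l1 = ratio k2 l2.
Proof.
move=> l10 l20 E; apply/eqP.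
rewrite /ratio GRing.eqr_div ?Num.Theory.pnatr_eq0 -?lt0n//.
by rewrite -!GRing.natrM E.
Qed.

Lemma card_gt0 (U : Type) (X : set U) n x : X x -> X #= `I_n -> 0 < n.
Proof.
move=> Xx; case: n => // Xn; rewrite II0 card_eq0 in Xn.
by move/eqP: Xn => X0; rewrite X0 in Xx.
Qed.

Lemma correspondence_finite_composite A G D
    (p : set (pformula N G)) (q : set (pformula N D))
    (C1 C2 : set (env N (G ++ D))) (x : env N G) : realizations p x ->
  correspondence A (realizations p) (realizations q) C1 ->
  correspondence A (realizations p) (realizations q) C2 ->
  finite_set [set z | exists y, C1 (ecat x y) /\ C2 (ecat z y)].
Proof.
move=> px HC1 HC2.
apply: (@sub_finite_set _ _ (\bigcup_(y in [set y | C1 (ecat x y)])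
    [set z | C2 (ecat z y)])).
  by move=> z [y [C1y C2y]]; exists y.
apply: bigcup_finite.
  by rewrite -(fibre_lE _ HC1); exact: corr_fin_l HC1 _ _.
move=> y /(corr_sub HC1)[_ qy]; rewrite -(fibre_rE _ HC2).
exact: corr_fin_r HC2 _ _.
Qed.

Lemma unimodular_correspondence :
  unimodular N K -> correspondence_unimodular N K.
Proof.
move=> HU A G D p q C1 C2 k1 l1 k2 l2 X Y sA cp cq HC1 U1 HC2 U2.
have cA := compact sA.
have [e C1e] := corr_nonempty HC1; have [e2 C2e] := corr_nonempty HC2.
rewrite -(ecat_take_drop e) in C1e; rewrite -(ecat_take_drop e2) in C2e.
have [pa qb] := corr_sub HC1 C1e; have [_ qb2] := corr_sub HC2 C2e.
move: (etake e) (edrop e) C1e pa qb => a b Cab pa qb {e}.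
(* A point of each correspondence makes the denominators positive, so the ratios can be compared by
   cross-multiplication. *)
have l10 : 0 < l1.
  by apply: (card_gt0 _ (U1.2 _ qb)); rewrite (fibre_rE _ HC1); exact: Cab.
have l20 : 0 < l2.
  by apply: (card_gt0 _ (U2.2 _ qb2)); rewrite (fibre_rE _ HC2); exact: C2e.
apply: ratio_eq => //.
have inv1 : tp_invariant A C1.
  by move=> u v; exact: (type_definable_eqtp (corr_tdef HC1)).
have inv2 : tp_invariant A C2.
  by move=> u v; exact: (type_definable_eqtp (corr_tdef HC2)).
(* The fibre of [W] over a pair (x, z) has the weight of that pair as its cardinality. *)
pose W := [set e : env N ((G ++ G) ++ D) |
  C1 (ecat (etake (etake e)) (edrop e)) /\
  C2 (ecat (edrop (etake e)) (edrop e))].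
have invW : tp_invariant A W.
  by apply: tp_invariantI; [apply: tp_invariant_tmap inv1|
    apply: tp_invariant_tmap inv2]; solve_tmap.
have WE x z y : W (ecat (ecat x z) y) = (C1 (ecat x y) /\ C2 (ecat z y)).
  by rewrite /W /= !(etakeK, edropK).
have Wtrans x z x' z' : eqtp A (ecat x z) (ecat x' z') ->
    (exists y, C1 (ecat x y) /\ C2 (ecat z y)) ->
    exists y, C1 (ecat x' y) /\ C2 (ecat z' y).
  move=> E [y Hy]; have := tp_invariant_ex cA invW E; rewrite /= => H.
  by have [|y' Hy'] := H; [exists y; rewrite WE | exists y'; rewrite WE in Hy'].
(* [S1] collects the [z] for which (a, z) has non-zero weight, [S2] the [x] for which (x, a)
   does. *)
pose S1 : set {classic env N G} :=
  [set z | exists y, C1 (ecat a y) /\ C2 (ecat z y)].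
pose S2 : set {classic env N G} :=
  [set x | exists y, C2 (ecat a y) /\ C1 (ecat x y)].
have fS1 : finite_set S1 by exact: correspondence_finite_composite pa HC1 HC2.
have fS2 : finite_set S2 by exact: correspondence_finite_composite pa HC2 HC1.
have [bs1 ub1 [sb1 Eb1]] : exists2 s : seq {classic env N D}, uniq s &
    size s = k1 /\ [set` s] = [set y | C1 (ecat a y)].
  by apply: card_eq_seq; rewrite -(fibre_lE _ HC1); exact: U1.1.
have [bs2 ub2 [sb2 Eb2]] : exists2 s : seq {classic env N D}, uniq s &
    size s = k2 /\ [set` s] = [set y | C2 (ecat a y)].
  by apply: card_eq_seq; rewrite -(fibre_lE _ HC2); exact: U2.1.
have [zs uzs [_ Ez]] := card_eq_seq (ncardP fS1).
have [xs uxs [_ Ex]] := card_eq_seq (ncardP fS2).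
have Sz z : (z \in zs) <-> S1 z by rewrite -Ez.
have Bb1 y : (y \in bs1) <-> C1 (ecat a y).
  by rewrite -[X in _ <-> X]/([set y | C1 (ecat a y)] y) -Eb1.
have Bb2 y : (y \in bs2) <-> C2 (ecat a y).
  by rewrite -[X in _ <-> X]/([set y | C2 (ecat a y)] y) -Eb2.
have Sx x : (x \in xs) <-> S2 x by rewrite -Ex.
(* Both products become total weights, one over [S1] and one over [S2]. *)
rewrite -sb1 -sb2 -(sum_fibres HC1 HC2 U2 Eb1 uzs Ez).
rewrite -(sum_fibres HC2 HC1 U1 Eb2 uxs Ex).
have S1p z : S1 z -> eqtp A z a.
  move=> [y [_ /(corr_sub HC2)[pz _]]]; exact: complete_type_eqtp cp pz pa.
have S2p x : S2 x -> eqtp A x a.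
  move=> [y [_ /(corr_sub HC1)[px _]]]; exact: complete_type_eqtp cp px pa.
(* A [z] in [S1] is linked to an [x] in [S2] when (a, z) and (x, a) have the same type over [A]. *)
apply: (weighted_double_count (T := {classic env N G})
  (r := fun z x => `[< eqtp A (ecat a z) (ecat x a) >])).
(* As [z] and [a] both realize [p], the pair (z, a) extends to an equivalent pair (a, x); swapping
   gives the link. *)
- move=> z /Sz S1z; have [x zx] := eqtp_extend cA a (S1p _ S1z).
  apply/hasP; exists x; last by apply/asboolP; exact: eqtp_swap zx.
  apply/Sx; have [y Hy] := Wtrans _ _ _ _ (eqtp_swap zx) S1z.
  by exists y; tauto.
- move=> x /Sx S2x; have [z xz] := eqtp_extend cA a (S2p _ S2x).
  apply/hasP; exists z; last by apply/asboolP; exact: eqtp_sym xz.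
  apply/Sz; apply: Wtrans xz _.
  by have [y Hy] := S2x; exists y; tauto.
- move=> z x /Sz S1z /Sx S2x /asboolP zx; split.
    (* Linked pairs have equal weight, both weights being fibres of [W] over pairs of the same
       type. *)
    have H1 := card_eq_count
      (fun y : {classic env N D} => `[< C2 (ecat z y) >]) ub1.
    have H2 := card_eq_count
      (fun y : {classic env N D} => `[< C1 (ecat x y) >]) ub2.
    have E1 : [set y | y \in bs1 /\ `[< C2 (ecat z y) >]] =
        [set y | W (ecat (ecat a z) y)].
      apply/seteqP; split=> y /=; rewrite WE.
        by move=> [/Bb1 ? /asboolP].
      by move=> [? ?]; split; [exact/Bb1 | exact/asboolP].
    have E2 : [set y | y \in bs2 /\ `[< C1 (ecat x y) >]] =
        [set y | W (ecat (ecat x a) y)].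
      apply/seteqP; split=> y /=; rewrite WE.
        by move=> [/Bb2 ? /asboolP].
      by move=> [? ?]; split; [exact/Bb2 | exact/asboolP].
    rewrite E1 in H1; rewrite E2 in H2.
    have := fibre_card cA invW zx H1.
    by rewrite (card_eql H2) => /card_eq_II.
  have az : eqtp A a z by apply: eqtp_sym; exact: S1p.
  (* The [z'] linked to [x] are the realizations of tp(z/Aa), and the [x'] linked to [z] are those
     with (x', a) of the type of (a, z). [unimodular_pair] equates their numbers. *)
  have T1 : [set z' : {classic env N G} |
      z' \in zs /\ `[< eqtp A (ecat a z') (ecat x a) >]] =
      [set z' | eqtp A (ecat a z) (ecat a z')].
    apply/seteqP; split=> z' /=.
      by move=> [_ /asboolP H]; exact: eqtp_trans zx (eqtp_sym H).
    move=> H; split; last by apply/asboolP; exact: eqtp_trans (eqtp_sym H) zx.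
    by apply/Sz; exact: Wtrans H S1z.
  have T2 : [set x' : {classic env N G} |
      x' \in xs /\ `[< eqtp A (ecat a z) (ecat x' a) >]] =
      [set x' | eqtp A (ecat a z) (ecat x' a)].
    apply/seteqP; split=> x' /=; first by move=> [_ /asboolP].
    move=> H; split; last by apply/asboolP.
    apply/Sx; have [y Hy] := Wtrans _ _ _ _ H S1z.
    by exists y; tauto.
  have [||n [Hn1 Hn2]] := unimodular_pair HU sA az.
  + by rewrite -T1; apply: sub_finite_set fS1 => z' [/Sz].
  + by rewrite -T2; apply: sub_finite_set fS2 => x' [/Sx].
  have H1 := card_eq_count (fun z' : {classic env N G} =>
    `[< eqtp A (ecat a z') (ecat x a) >]) uzs.
  have H2 := card_eq_count (fun x' : {classic env N G} =>
    `[< eqtp A (ecat a z) (ecat x' a) >]) uxs.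
  rewrite T1 (card_eql Hn1) in H1; rewrite T2 (card_eql Hn2) in H2.
  by move/card_eq_II: H1 => <-; move/card_eq_II: H2 => <-.
Qed.


(** * From functions to correspondences through graphs *)

(** Compactness is applied to the [A]-definable sets containing all realizations of some finite part
    of [p], a family closed under intersection. *)
Lemma realizations_complete A G (p : set (pformula N G)) :
  small K A -> complete_type A p -> realizations p !=set0.
Proof.
move=> sA [pA pfin _].
have AE : adjoin A (tt : env N [::]) = A by rewrite /adjoin setU0.
have cA := @compact _ sA [::] tt; rewrite AE in cA.
pose F := [set X | definable A X /\
  exists q, [/\ q `<=` p, finite_set q & realizations q `<=` X]].
have [||||x Fx] := @cA _ F.
- split; first exact: definableT.
  by exists set0; split=> //; exact: finite_set0.
- move=> X Y [AX [q [qp qf qX]]] [AY [r [rp rf rY]]].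
  split; first exact: definableI.
  exists (q `|` r); split; first by move=> f [/qp|/rp].
    by rewrite finite_setU.
  by move=> x qrx; split; [apply: qX|apply: rY] => f Hf; apply: qrx;
    [left|right].
- by move=> X [].
- by move=> X [_ [q [qp qf qX]]]; have [x /qX] := pfin _ qp qf; exists x.
exists x => f pf; apply: (Fx (psat f)); split.
  by exists f => //; exact: pA.
exists [set f]; split; [by move=> _ ->|exact: finite_set1|].
by move=> y; apply.
Qed.

Lemma realizationsPn G (p : set (pformula N G)) (x : env N G) :
  ~ realizations p x -> exists2 f, p f & ~ psat f x.
Proof.
move=> H; apply: contrapT => Hp; apply: H => f pf; apply: contrapT => fx.
by apply: Hp; exists f.
Qed.

Definition graph_on G D (X : set (env N G)) (Y : set (env N D))
    (f : env N G -> env N D) : set (env N (G ++ D)) :=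
  [set e | [/\ X (etake e), Y (edrop e) & edrop e = f (etake e)]].

(** The graph is cut out by [p] on the first coordinate, [q] on the second, and the definable set
    [Z]; a tuple outside it violates one of the three. Its left fibres are singletons and its right
    fibres are those of [f]. *)
Lemma graph_correspondence A G D (p : set (pformula N G))
    (q : set (pformula N D)) (f : env N G -> env N D) k :
  let X := realizations p in let Y := realizations q in
  small K A -> complete_type A p -> complete_type A q ->
  rel_definable_fun A X Y f -> fibres_of_size X Y f k ->
  correspondence A X Y (graph_on X Y f) /\ uniform X Y (graph_on X Y f) 1 k.
Proof.
move=> X Y sA cp cq [fXY [Z AZ ZE]] fk.
have gE x y : graph_on X Y f (ecat x y) <-> [/\ X x, Y y & y = f x].
  by rewrite /graph_on /= etakeK edropK.
have Fl x : X x -> fibre_l Y (graph_on X Y f) x = [set f x].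
  move=> Xx; apply/seteqP; split=> y /=; first by move=> [_ /gE[]].
  by move=> ->; split; [exact: fXY|apply/gE; split=> //; exact: fXY].
have Fr y : Y y -> fibre_r X (graph_on X Y f) y = X `&` f @^-1` [set y].
  move=> Yy; apply/seteqP; split=> x /=; first by move=> [Xx /gE[_ _ ->]].
  by move=> [Xx fx]; split=> //; apply/gE.
split; last first.
  split=> [x Xx|y Yy]; [rewrite Fl//; exact: card_set1|].
  by rewrite Fr//; exact: fk.
have [pA _ _] := cp; have [qA _ _] := cq.
split; [by exists p|by exists q| | | |by move=> x /Fl->; exact: finite_set1|].
- apply: type_definable_bigcap => e Ce.
  have [Xe|/realizationsPn[g pg ge]] := EM (X (etake e)); last first.
    exists (@etake _ _ G D @^-1` psat g); last by split=> // u [/(_ _ pg)].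
    apply: definable_preim; first exact: tmap_take.
    by exists g => //; exact: pA.
  have [Ye|/realizationsPn[g qg ge]] := EM (Y (edrop e)); last first.
    exists (@edrop _ _ G D @^-1` psat g); last by split=> // u [_ /(_ _ qg)].
    apply: definable_preim; first exact: tmap_drop.
    by exists g => //; exact: qA.
  exists Z => //; split=> [u [Xu Yu uf]|].
    by rewrite -(ecat_take_drop u); apply/ZE.
  rewrite -(ecat_take_drop e) => /ZE fe; apply: Ce; split=> //.
  exact: fe.
- have [x Xx] := realizations_complete sA cp; exists (ecat x (f x)).
  by apply/gE; split=> //; exact: fXY.
- by move=> x y /gE[].
- by move=> y Yy; apply/finite_setP; exists k; rewrite Fr//; exact: fk.
Qed.

Lemma correspondence_functional :
  correspondence_unimodular N K -> functionally_unimodular N K.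
Proof.
move=> HC A G D p q f g k l X Y sA cp cq rf fk rg gl.
have [C1 U1] := graph_correspondence sA cp cq rf fk.
have [C2 U2] := graph_correspondence sA cp cq rg gl.
have := HC A G D p q _ _ _ _ _ _ sA cp cq C1 U1 C2 U2.
(* With the convention that 0 is its own inverse, inversion is injective on all rationals, so empty
   fibres are covered too. *)
rewrite /ratio !GRing.mul1r => /GRing.invr_inj/eqP.
by rewrite Num.Theory.eqr_nat => /eqP.
Qed.

(** * From functions to unimodularity through projections *)

Lemma functional_unimodular : functionally_unimodular N K -> unimodular N K.
Proof.
move=> HF A G a b sA /eq_tp ab [acla aclb]; have cA := compact sA.
have inv : tp_invariant A [set e | eqtp A (ecat a b) e].
  exact: tp_invariant_eqtp.
have defZ (h : env N (G ++ G) -> env N G) : tmap h ->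
    rel_definable_fun A (realizations (tp (ecat a b) A))
      (realizations (tp a A)) h <->
    set_fun (realizations (tp (ecat a b) A)) (realizations (tp a A)) h.
  move=> Hh; split=> [[]//|sf]; split=> //.
  exists [set e | edrop e = h (etake e)].
    apply: definable_eq; first exact: tmap_drop.
    by apply: (tmap_app Hh); exact: tmap_take.
  by move=> x y _ _ /=; rewrite etakeK edropK.
apply/esym; apply: (HF A (G ++ G) G (tp (ecat a b) A) (tp a A)
  (@etake _ _ G G) (@edrop _ _ G G)) => //; try exact: complete_tp.
- apply/defZ; first exact: tmap_take.
  move=> e; rewrite !eqtp_realizations -(ecat_take_drop e) => /eqtp_take.
  by rewrite etakeK.
(* Over [a] the fibre of the first projection is counted by m(b/Aa); the count passes to every [x]
   of the same type. *)
- move=> x /eqtp_realizations ax.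
  have := fibre_card cA inv ax (mult_adjoin cA aclb).
  have -> : realizations (tp (ecat a b) A) `&` @etake _ _ G G @^-1` [set x] =
      ecat x @` [set y | eqtp A (ecat a b) (ecat x y)].
    apply/seteqP; split=> e /=.
      rewrite eqtp_realizations => -[+ ex]; rewrite -(ecat_take_drop e) ex => H.
      by exists (edrop e).
    by move=> [y H <-]; rewrite eqtp_realizations etakeK.
  move=> H; rewrite (card_eql (inj_card_eq _)) // => y y' _ _.
  by move=> /ecat_inj[].
- apply/defZ; first exact: tmap_drop.
  move=> e; rewrite !eqtp_realizations -(ecat_take_drop e) => /eqtp_drop.
  by rewrite edropK; exact: eqtp_trans.
(* For the second projection the count m(a/Ab) starts over [b], which has the type of [a] and hence
   of [x]. *)
- move=> x /eqtp_realizations ax.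
  pose sw (e : env N (G ++ G)) := ecat (edrop e) (etake e).
  have inv' : tp_invariant A [set e | eqtp A (ecat b a) e].
    exact: tp_invariant_eqtp.
  have := fibre_card cA inv' (eqtp_trans (eqtp_sym ab) ax)
    (mult_adjoin cA acla).
  have -> : realizations (tp (ecat a b) A) `&` @edrop _ _ G G @^-1` [set x] =
      (fun y => ecat y x) @` [set y | eqtp A (ecat b a) (ecat x y)].
    apply/seteqP; split=> e /=.
      rewrite eqtp_realizations => -[+ ex]; rewrite -(ecat_take_drop e) ex => H.
      by exists (etake e) => //; exact: eqtp_swap.
    move=> [y H <-]; rewrite eqtp_realizations edropK; split=> //.
    exact: eqtp_swap.
  move=> H; rewrite (card_eql (inj_card_eq _)) // => y y' _ _.
  by move=> /ecat_inj[].
Qed.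

End Equivalences.

(** * Small sets *)

Section Cardinals.

Lemma card_le_surj (T U : Type) (A : set T) (B : set U) (g : U -> T) :
  A `<=` g @` B -> A #<= B.
Proof.
by move=> /subset_card_le H; exact: card_le_trans H (card_image_le _ _).
Qed.

Lemma card_le_inj (T U : Type) (A : set T) (B : set U) (f : T -> U) :
  set_fun A B f -> set_inj A f -> A #<= B.
Proof.
move=> fAB fi; have [] : $|{injfun A >-> B}| by apply/injfunPex; exists f.
by move=> g; exact: inj_card_le g.
Qed.

(* A maximal family of disjoint countable subsets covers [A] up to a finite
   set, so that [A] is equipotent to [D * nat] for the family [D]. *)
Lemma infinite_card_mul_nat (T : Type) (A : set T) :
  infinite_set A -> A `*` [set: nat] #<= A.
Proof.
elim/Ppointed: T => T in A *; first by rewrite emptyE => /(_ (finite_set0 _)).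
move=> Ainf; pose B := [set f : nat -> T | injective f /\ range f `<=` A].
have [D [DB tD maxD]] :=
  ex_maximal_disjoint_subcollection (fun f : nat -> T => range f) B.
(* An infinite remainder would contain a further countable set, contradicting maximality. *)
have Rfin : finite_set (A `\` \bigcup_(f in D) range f).
  apply: contrapT => /infiniteP.
  move=> /pcard_leP[f].
  have fR n : (A `\` \bigcup_(f in D) range f) (f n) by exact: funS.
  have finj : injective f by move=> m n; apply: inj; exact: mem_set.
  apply: (maxD (D `|` [set (f : nat -> T)])).
  - split=> [g|sub]; first by left.
    have Df : D f by apply: sub; right.
    by have [_] := fR 0; apply; exists f => //; exists 0.
  - move=> g [/DB//|->]; split=> // _ [n _ <-]; exact: (fR n).1.
  - move=> g h [Dg|->] [Dh|->] // [x []].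
    + by move=> ? ?; apply: tD => //; exists x.
    + by move=> gx [n _ fx]; case: (fR n).2; exists g => //; rewrite fx.
    + by move=> [n _ fx] hx; case: (fR n).2; exists h => //; rewrite fx.
have [f0 Df0] : D !=set0.
  apply/set0P/eqP => D0; apply: Ainf; apply: sub_finite_set Rfin.
  by rewrite D0 bigcup_set0 setD0.
have /(@finite_seqP {classic T})[s Es] := Rfin.
(* Even indices enumerate the ranges of the members of [D], odd ones the finite remainder, so [g]
   covers [A]. *)
pose g (u : (nat -> T) * nat) : T :=
  if odd u.2 then nth (f0 0 : {classic T}) s u.2./2 else u.1 u.2./2.
have gA : A `<=` g @` (D `*` setT).
  move=> x Ax; have [[f Df [n _ <-]]|Rx] := EM ((\bigcup_(f in D) range f) x).
    by exists (f, n.*2) => //; rewrite /g /= odd_double doubleK.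
  have xs : (x : {classic T}) \in s.
    by have : (A `\` \bigcup_(f in D) range f) x by []; rewrite Es.
  exists (f0, (index (x : {classic T}) s).*2.+1) => //.
  by rewrite /g /= odd_double uphalf_double /= nth_index.
apply: (@card_le_trans _ _ _ (D `*` [set: nat])).
  (* Decoding one number into two absorbs the extra factor [nat]; the default is harmless because
     only surjectivity is sought. *)
  pose dec (m : nat) : nat * nat := odflt (0, 0) (choice.unpickle m).
  apply: (@card_le_surj _ _ _ _
    (fun u : (nat -> T) * nat => (g (u.1, (dec u.2).1), (dec u.2).2))).
  move=> [x k] [/= /gA[[f n] [Df _] /= <-] _].
  by exists (f, choice.pickle (n, k)) => //=; rewrite /dec /= choice.pickleK.
apply: (@card_le_inj _ _ _ _ (fun u : (nat -> T) * nat => u.1 u.2)).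
  by move=> [f n] [/DB[_ fA] _]; apply: fA; exists n.
move=> [f m] [h n] /set_mem[/= Df _] /set_mem[/= Dh _] E.
have fh : f = h by apply: tD => //; exists (f m); split; [exists m|exists n].
by rewrite -fh in E *; have [fi _] := DB f Df; rewrite (fi _ _ E).
Qed.

(** A finite [A] would make the union finite; for infinite [A] the union is covered by an image of
    [A * nat], hence is no larger than [A]. Contraposed, smallness survives replacing each parameter
    by finitely many. *)
Lemma card_le_bigcup_finite (K T U : Type) (A : set T) (F : T -> set U) :
  infinite_set [set: K] -> (forall x, finite_set (F x)) ->
  [set: K] #<= \bigcup_(x in A) F x -> [set: K] #<= A.
Proof.
move=> Kinf Ffin KF.
have [Afin|Ainf] := EM (finite_set A).
  by case: Kinf; apply: card_le_finite KF _; exact: bigcup_finite.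
apply: card_le_trans KF _; apply: card_le_trans (infinite_card_mul_nat Ainf).
have [F0|/eqP/set0P[u0 _]] := EM (\bigcup_(x in A) F x = set0).
  by rewrite F0; exact: card_ge0.
have : forall x, exists s : seq {classic U}, F x = [set` s].
  by move=> x; apply/(@finite_seqP {classic U}).
move=> /choice[s Es].
apply: (@card_le_surj _ _ _ _
  (fun v : T * nat => nth (u0 : {classic U}) (s v.1) v.2)).
move=> u [x Ax]; rewrite Es /= => us.
by exists (x, index (u : {classic U}) (s x)) => //=; rewrite nth_index.
Qed.

End Cardinals.

(** * Compactness of M^eq *)

Section Imaginaries.
Variables (L : language) (M : structure L).
Implicit Types (E : defeq M) (s : lsort (eqlang M)).
Implicit Types (G D P : seq (lsort (eqlang M))).

(** Every element of M^eq is coded by a finite tuple of [M]: a real element by itself, an imaginary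
    by a representative of its class. [flat] and [fproj] extend this to tuples. *)
Definition rep s : seq (lsort L) :=
  match s with Home t => [:: t] | Imag E => ectx E end.

Definition rproj s : env M (rep s) -> Meq M s :=
  match s with Home t => fun e => e.1 | Imag E => @eqproj L M E end.

Fixpoint flat G : seq (lsort L) :=
  if G is s :: G' then rep s ++ flat G' else [::].

Fixpoint fproj G : env M (flat G) -> env (Meq M) G :=
  match G with
  | [::] => fun e => e
  | s :: G' => fun e => (rproj (etake e), fproj (edrop e))
  end.

Lemma rproj_surj s (x : Meq M s) : exists e, rproj e = x.
Proof.
case: s x => [t|E] x; first by exists (x, tt).
by case: x => X [e Xe]; exists e; apply: eq_exist.
Qed.

Definition rrep s (x : Meq M s) : env M (rep s) := projT1 (cid (rproj_surj x)).

Lemma rrepK s (x : Meq M s) : rproj (rrep x) = x.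
Proof. by rewrite /rrep; case: cid. Qed.

Fixpoint frep G : env (Meq M) G -> env M (flat G) :=
  match G with
  | [::] => fun e => e
  | s :: G' => fun e => ecat (rrep e.1) (frep e.2)
  end.

Lemma frepK G (e : env (Meq M) G) : fproj (frep e) = e.
Proof.
elim: G e => [|s G IH] //= [x e] /=.
by rewrite etakeK edropK rrepK IH.
Qed.

Lemma eqprojP E (x y : env M (ectx E)) :
  eqproj x = eqproj y <-> sat (efml E) (ecat x y).
Proof.
have [rE sE tE] := eequiv E; split.
  move=> /(congr1 (@proj1_sig _ _)) /= xy.
  by have : eclass y y by [exact: rE]; rewrite -xy.
move=> xy; apply: eq_exist; apply/seteqP; split=> z xz.
  by apply: tE xz; exact: sE.
exact: tE xy xz.
Qed.

Fixpoint unflat (D : seq (lsort L)) :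
    env M (flat (map (@Home L M) D)) -> env M D :=
  match D with
  | [::] => fun e => e
  | s :: D' => fun e => (e.1, unflat e.2)
  end.

Lemma unhome_fproj (D : seq (lsort L)) (e : env M (flat (map (@Home L M) D))) :
  unhome (fproj e) = unflat e.
Proof. by elim: D e => [|s D IH] //= e; rewrite IH. Qed.

Lemma tmap_unflat (D : seq (lsort L)) : tmap (@unflat D).
Proof.
elim: D => [|s D IH] //=; split; first by exists (Tvar (Vz s _)).
exact: (tmap_app IH (tmap_tail M s _)).
Qed.

Lemma eqvar_lift G s (x : var G s) :
  exists2 h : env M (flat G) -> env M (rep s), tmap h &
    forall e, elookup x (fproj e) = rproj (h e).
Proof.
elim: x => [{}s {}G|{}s t {}G x [h Hh IH]] /=.
  by exists (@etake _ M (rep s) (flat G)) => //; exact: tmap_take.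
exists (fun e => h (edrop e)) => //.
exact/(tmap_app Hh)/tmap_drop.
Qed.

(** Symbols of [L] act on representatives as in [M], while the projection to a quotient becomes, up
    to flattening, the identity on representatives. *)
Lemma eqterm_lift G :
  (forall s (t : term G s), exists2 h : env M (flat G) -> env M (rep s),
    tmap h & forall e, teval (fproj e) t = rproj (h e)) /\
  (forall D (ts : terms G D), exists2 h : env M (flat G) -> env M (flat D),
    tmap h & forall e, tseval (fproj e) ts = fproj (h e)).
Proof.
apply: term_mutind => /=.
- exact: eqvar_lift.
- case=> [f|E] ts [h Hh IH].
    exists (fun e => (finterp (unflat (h e)), tt)).
      have [us Hus] := tmap_terms (tmap_app (tmap_unflat _) Hh).
      by split=> //; exists (Tapp us) => e /=; rewrite Hus.
    by move=> e /=; rewrite IH unhome_fproj.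
  exists (fun e => unflat (h e)); first exact: tmap_app (tmap_unflat _) Hh.
  by move=> e /=; rewrite IH unhome_fproj.
- by exists (fun=> tt).
- move=> s D t [h Hh IHt] ts [k Hk IHts].
  exists (fun e => ecat (h e) (k e)); first exact: tmap_cat.
  by move=> e; rewrite etakeK edropK IHt IHts.
Qed.

(** Equality of imaginaries turns into the formula defining the equivalence relation, and a
    quantifier over classes into a block of quantifiers over representatives. *)
Lemma eqformula_lift G (phi : formula G) :
  zdef ((@fproj G) @^-1` (@sat _ (Meq M) G phi)).
Proof.
elim: phi => {G}.
- move=> G s t u.
  have [h Hh Et] := (eqterm_lift G).1 _ t.
  have [k Hk Eu] := (eqterm_lift G).1 _ u.
  have -> : (@fproj G) @^-1` (@sat _ (Meq M) G (Feq t u)) =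
      [set e | rproj (h e) = rproj (k e)].
    by apply/seteqP; split=> e /=; rewrite Et Eu.
  case: s h k Hh Hk {t u Et Eu} => [s|E] h k Hh Hk.
    have := zdef_eq Hh Hk; congr zdef; apply/seteqP; split=> e /=.
      by move=> ->.
    by case: (h e) (k e) => [x []] [y []] /= ->.
  have HE : zdef (sat (M := M) (efml E)) by exists (efml E).
  have := zdef_preim (tmap_cat Hh Hk) HE; congr zdef.
  by apply/seteqP; split=> e /= /eqprojP.
- move=> G r ts; have [h Hh Ets] := (eqterm_lift G).2 _ ts.
  have [us Hus] := tmap_terms (tmap_app (tmap_unflat _) Hh).
  by exists (Frel us) => e /=; rewrite Ets unhome_fproj Hus.
- move=> G; exact: zdef0.
- move=> G phi IH1 psi IH2; exact: zdef_imp IH1 IH2.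
- move=> G s phi IH; have := zdef_all IH; congr zdef.
  apply/seteqP; split=> e /= H x.
    by have := H (rrep x); rewrite etakeK edropK rrepK.
  by rewrite edropK; exact: H.
Qed.

Definition reps (A : set {s : lsort (eqlang M) & Meq M s}) :
    set {s : lsort L & M s} :=
  \bigcup_(u in A) elems (rrep (projT2 u)).

Lemma elems_frep G (c : env (Meq M) G) A :
  elems c `<=` A -> elems (frep c) `<=` reps A.
Proof.
elim: G c => [|s G IH] /=; first by move=> _ _ u [].
move=> [x c] /=; rewrite subUset => -[Ax Ac].
rewrite elems_ecat subUset; split; last exact: IH.
by move=> u Hu; exists (existT _ s x) => //; exact: Ax.
Qed.

(** The two contexts are equal but not convertible; a term map between them takes the place of a
    cast. *)
Lemma tmap_flat_cat G D :
  exists2 h : env M (flat G ++ flat D) -> env M (flat (G ++ D)),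
  tmap h & forall x y, fproj (h (ecat x y)) = ecat (fproj x) (fproj y).
Proof.
elim: G => [|s G [h Hh IH]] /=.
  by exists (fun e => e) => //; exact: tmap_id.
exists (fun e => ecat (etake (etake e)) (h (ecat (edrop (etake e)) (edrop e)))).
  by apply: tmap_cat; last (apply: (tmap_app Hh)); solve_tmap.
by move=> x y; rewrite !(etakeK, edropK) IH.
Qed.

Lemma definable_fproj A G (X : set (env (Meq M) G)) :
  definable A X -> definable (reps A) (@fproj G @^-1` X).
Proof.
move=> [[P f c] /= Ac ->]; apply/definableP.
have [h Hh Eh] := tmap_flat_cat G P.
exists (flat P), (frep c), (h @^-1` (@fproj (G ++ P) @^-1` sat f)); split.
- exact: elems_frep.
- exact: zdef_preim Hh (eqformula_lift f).
- by apply/seteqP; split=> x /=; rewrite Eh frepK.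
Qed.

(** The family is pulled back along [fproj]; the image of a common point is a common point of the
    original family. *)
Lemma compact_Meq A : compact_over (reps A) -> compact_over A.
Proof.
move=> HA G F FT FI FA F0.
have [||||x Fx] := @HA (flat G) [set X | exists2 Y, F Y & X = @fproj G @^-1` Y].
- by exists setT.
- move=> _ _ [X FX ->] [Y FY ->]; exists (X `&` Y) => //; exact: FI.
- by move=> _ [X FX ->]; apply: definable_fproj; exact: FA.
- by move=> _ [X /F0[x Xx] ->]; exists (frep x); rewrite /= frepK.
by exists (fproj x) => X FX; apply: (Fx (@fproj G @^-1` X)); exists X.
Qed.

End Imaginaries.

(** * Smallness of the parameter sets, and conclusion *)

Fixpoint imp_depth (L : language) (G : seq (lsort L)) (phi : formula G) : nat :=
  if phi is Fimp _ phi' _ then (imp_depth phi').+1 else 0.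

(** The iterated negations of falsity are pairwise distinct, as [imp_depth] counts the negations. *)
Lemma infinite_formulas (L : language) :
  [set: nat] #<= [set: {G : seq (lsort L) & formula G}].
Proof.
pose f n : {G : seq (lsort L) & formula G} :=
  existT _ [::] (iter n (@Fneg L [::]) (Fbot [::])).
apply: (@card_le_inj _ _ _ _ f) => // m n _ _.
have fK k : imp_depth (projT2 (f k)) = k by elim: k => //= k ->.
by move=> /(congr1 (fun u => imp_depth (projT2 u))); rewrite !fK.
Qed.

Lemma monster_infinite (L : language) (T : theory L) (K : Type)
    (M : structure L) :
  monster_model T K M -> infinite_set [set: K].
Proof.
move=> [_ /negP HK _ _] /finite_setP[n Kn]; apply: HK.
rewrite (card_le_eql Kn); apply: card_le_trans (infinite_formulas L).
exact: card_leT.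
Qed.

Lemma small_reps (L : language) (M : structure L) (K : Type)
    (A : set {s : lsort (eqlang M) & Meq M s}) :
  infinite_set [set: K] -> small K A -> small K (reps A).
Proof.
move=> Kinf; apply: contraNN; apply: card_le_bigcup_finite => // u.
exact: finite_elems.
Qed.

Lemma small_adjoin (L : language) (N : structure L) (K : Type)
    (A : set {s : lsort L & N s}) (G : seq (lsort L)) (a : env N G) :
  infinite_set [set: K] -> small K A -> small K (adjoin A a).
Proof.
move=> Kinf; apply: contraNN => KA.
(* The empty set is treated apart, since the cover by the sets {v} together with the entries of [a],
   for [v] in [A], would then be empty. *)
have [A0|/eqP/set0P[u Au]] := EM (A = set0).
  case: Kinf; apply: card_le_finite KA _; rewrite /adjoin A0 set0U.
  exact: finite_elems.
apply: (@card_le_bigcup_finite _ _ _ A (fun v => [set v] `|` elems a)) => //.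
  move=> v; rewrite finite_setU; split; first exact: finite_set1.
  exact: finite_elems.
apply: card_le_trans KA _; apply: subset_card_le => v [Av|av].
  by exists v => //; left.
by exists u => //; right.
Qed.

Theorem theorem2p11 (L : language) (T : theory L) (K : Type) (M : structure L) :
  complete_theory T -> monster_model T K M ->
  (unimodular (Meq M) K <-> correspondence_unimodular (Meq M) K) /\
  (correspondence_unimodular (Meq M) K <-> functionally_unimodular (Meq M) K).
Proof.
move=> _ HM; have Kinf := monster_infinite HM; have [_ _ Hsat _] := HM.
have cpt A : small K A ->
    forall G (a : env (Meq M) G), compact_over (adjoin A a).
  (* Saturation is available in [M] only, so the parameters are first replaced by their
     representatives. *)
  move=> sA G a; apply: compact_Meq; apply: (saturated_compact Hsat).
  by apply: small_reps => //; exact: small_adjoin.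
have h12 := unimodular_correspondence cpt.
have h23 := correspondence_functional cpt.
have h31 := functional_unimodular cpt.
by split; split; auto.
Qed.
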